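(* Let $F$ be an infinite perfect field of characteristic different from $2$, let $G=\mathrm{Aut}(\mathbf{O})$ be the automorphism group (of type $G_2$) of the octonion algebra $\mathbf{O}$ over $F$, let $\mathbf{O}_0$ be the space of traceless octonions, and let $n\ge3$. Then the field of rational invariants $F(\mathbf{O}_0^n)^G$ is a field of rational functions over $F$ in $7n-14$ variables, i.e. it is purely transcendental over $F$ of transcendence degree $7n-14$.
   Context: $\mathbf{O}$ is the Zorn vector-matrix algebra over $F$, consisting of all $a=\begin{pmatrix}\alpha&\mathbf{u}\\ \mathbf{v}&\beta\end{pmatrix}$ with $\alpha,\beta\in F$, $\mathbf{u},\mathbf{v}\in F^3$, and multiplication $$\begin{pmatrix}\alpha&\mathbf{u}\\ \mathbf{v}&\beta\end{pmatrix}\begin{pmatrix}\alpha'&\mathbf{u}'\\ \mathbf{v}'&\beta'\end{pmatrix}=\begin{pmatrix}\alpha\alpha'+\mathbf{u}\cdot\mathbf{v}'&\alpha\mathbf{u}'+\beta'\mathbf{u}-\mathbf{v}\times\mathbf{v}'\\ \alpha'\mathbf{v}+\beta\mathbf{v}'+\mathbf{u}\times\mathbf{u}'&\beta\beta'+\mathbf{v}\cdot\mathbf{u}'\end{pmatrix}.$$ The trace is $t(a)=\alpha+\beta$, and $\mathbf{O}_0=\{a: t(a)=0\}$, which is $G$-stable. $G$ acts diagonally on $\mathbf{O}_0^n$, on $F[\mathbf{O}_0^n]$ by $(gf)(w)=f(g^{-1}w)$, and hence on its fraction field $F(\mathbf{O}_0^n)$. *)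

(* Defs.v *)
From HB Require Import structures.
From mathcomp Require Import all_boot all_order all_algebra.
From mathcomp Require Import generic_quotient.
From mathcomp Require Import mpoly ring.

Set Implicit Arguments.
Unset Strict Implicit.
Unset Printing Implicit Defensive.

Import GRing.Theory.
Local Open Scope ring_scope.

Notation "x %:F" := (@FracField.tofrac _ x).

Definition infinite_field (F : fieldType) : Prop :=
  forall s : seq F, exists x : F, x \notin s.

(* Characteristic 0, or characteristic p with every element a p-th power. *)
Definition perfect_field (F : fieldType) : Prop :=
  forall p : nat, p \in [pchar F] -> forall x : F, exists y : F, y ^+ p = x.

Definition algebraically_independent (F L : fieldType)
    (iota : {rmorphism F -> L}) (d : nat) (x : 'I_d -> L) : Prop :=
  forall p : {mpoly F[d]}, mmap iota x p = 0 -> p = 0.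

(* y belongs to the subfield iota(F)(x_0, ..., x_(d-1)) of L. *)
Definition in_generated_field (F L : fieldType)
    (iota : {rmorphism F -> L}) (d : nat) (x : 'I_d -> L) (y : L) : Prop :=
  exists p q : {mpoly F[d]},
    mmap iota x q != 0 /\ y = mmap iota x p / mmap iota x q.

(* The subset K of L is a subfield F(x_0, ..., x_(d-1)) with the x_i
   algebraically independent over F (embedded in L by iota). *)
Definition purely_transcendental (F L : fieldType)
    (iota : {rmorphism F -> L}) (K : L -> Prop) (d : nat) : Prop :=
  exists x : 'I_d -> L,
    algebraically_independent iota x /\
    (forall y : L, K y <-> in_generated_field iota x y).

(* (((alpha, u), v), beta) stands for the vector matrix
   ( alpha  u    )
   ( v      beta ). *)
Definition octonion (F : fieldType) : Type :=
  (F^o * 'rV[F]_3 * 'rV[F]_3 * F^o)%type.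

HB.instance Definition _ (F : fieldType) :=
  Vector.copy (octonion F) (F^o * 'rV[F]_3 * 'rV[F]_3 * F^o)%type.

Section Octonions.
Variable F : fieldType.
Local Notation O := (octonion F).
Implicit Types (a b : O) (u v : 'rV[F]_3).

Definition zorn (alpha : F) u v (beta : F) : O := (alpha, u, v, beta).

Definition oul a : F := a.1.1.1.
Definition our a : 'rV[F]_3 := a.1.1.2.
Definition odl a : 'rV[F]_3 := a.1.2.
Definition odr a : F := a.2.

Definition dotv u v : F := \sum_(i < 3) u 0 i * v 0 i.

(* Indices are added modulo 3. *)
Definition crossv u v : 'rV[F]_3 :=
  \row_(i < 3) (u 0 (i + 1) * v 0 (i + 2%:R) - u 0 (i + 2%:R) * v 0 (i + 1)).

Definition omul a b : O :=
  zorn (oul a * oul b + dotv (our a) (odl b))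
       (oul a *: our b + odr b *: our a - crossv (odl a) (odl b))
       (oul b *: odl a + odr a *: odl b + crossv (our a) (our b))
       (odr a * odr b + dotv (odl a) (our b)).

Definition one_oct : O := zorn 1 0 0 1.

Definition otrace a : F := oul a + odr a.

Definition onorm a : F := oul a * odr a - dotv (our a) (odl a).

Record octAut := OctAut {
  octAut_val :> 'End(O);
  octAutM : {morph octAut_val : a b / omul a b};
  octAut_bij : bijective octAut_val }.

Lemma octAut_lker0 (g : octAut) : lker g == 0%VS.
Proof. by apply/lker0P; exact: bij_inj (octAut_bij g). Qed.

Fact octAutVM (g : octAut) :
  {morph (g^-1)%VF : a b / omul a b}.
Proof.
move=> a b; apply: (bij_inj (octAut_bij g)).
by rewrite octAutM !(lker0_lfunVK (octAut_lker0 g)).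
Qed.

Fact octAutV_bij (g : octAut) : bijective (g^-1)%VF.
Proof.
exists g; first exact: lker0_lfunVK (octAut_lker0 g).
exact: lker0_lfunK (octAut_lker0 g).
Qed.

Definition octAutV (g : octAut) : octAut :=
  OctAut (@octAutVM g) (octAutV_bij g).

Lemma omul_sqr a : omul a a = otrace a *: a - onorm a *: one_oct.
Proof.
have Edot u v : dotv u v = dotv v u.
  by apply: eq_bigr => i _; rewrite mulrC.
have Ecross u : crossv u u = 0.
  by apply/rowP => i; rewrite !mxE mulrC subrr.
case: a => [[[al u] v] be].
rewrite /omul /otrace /onorm /zorn /oul /our /odl /odr /= !Ecross (Edot v u).
by congr (_, _, _, _); rewrite /= ?scaler0 ?subr0 ?addr0 ?scalerDl //;
   rewrite /GRing.scale /=; ring.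
Qed.

Lemma dotv0l u : dotv 0 u = 0.
Proof. by apply: big1 => i _; rewrite mxE mul0r. Qed.

Lemma dotv0r u : dotv u 0 = 0.
Proof. by apply: big1 => i _; rewrite mxE mulr0. Qed.

Lemma crossv0l u : crossv 0 u = 0.
Proof. by apply/rowP => i; rewrite !mxE !mul0r subrr. Qed.

Lemma crossv0r u : crossv u 0 = 0.
Proof. by apply/rowP => i; rewrite !mxE !mulr0 subrr. Qed.

Let oct0E := (dotv0l, dotv0r, crossv0l, crossv0r,
  mul0r, mulr0, mul1r, mulr1, scale0r, scaler0, scale1r, addr0, add0r, subr0).

Lemma mul1o a : omul one_oct a = a.
Proof.
case: a => [[[al u] v] be].
by rewrite /omul /one_oct /zorn /oul /our /odl /odr /= !oct0E.
Qed.

Lemma mulo1 a : omul a one_oct = a.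
Proof.
case: a => [[[al u] v] be].
by rewrite /omul /one_oct /zorn /oul /our /odl /odr /= !oct0E.
Qed.

Lemma octAut1 (g : octAut) : g one_oct = one_oct.
Proof.
rewrite -[LHS]mulo1; have [h _ hK] := octAut_bij g.
by rewrite -[one_oct in X in omul _ X]hK -octAutM mul1o hK.
Qed.

(* The traceless octonions are stable under automorphisms. *)
Lemma otrace_octAut (g : octAut) a : otrace (g a) = otrace a.
Proof.
apply/eqP; rewrite -subr_eq0; apply/negPn/negP => t_neq0.
have E : (otrace (g a) - otrace a) *: g a
         = (onorm (g a) - onorm a) *: one_oct.
  have gZ c x : g (c *: x) = c *: g x by exact: linearZ.
  have gB x y : g (x - y) = g x - g y by exact: linearB.
  have := congr1 g (omul_sqr a); rewrite octAutM omul_sqr gB !gZ octAut1.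
  move/eqP; rewrite subr_eq.
  move/eqP=> H; rewrite !scalerBl H.
  by rewrite addrAC (addrC (_ *: g a)) addrK addrC -!scalerBl.
pose c := (otrace (g a) - otrace a)^-1 * (onorm (g a) - onorm a).
have ga : g a = c *: one_oct.
  by rewrite -scalerA -E scalerA mulVf // scale1r.
have ea : a = c *: one_oct.
  by apply: (bij_inj (octAut_bij g)); rewrite linearZ /= octAut1.
by move/eqP: t_neq0; apply; rewrite ga -ea subrr.
Qed.

(* The traceless octonions are identified with F^7 by
   ( alpha  u      )
   ( v      -alpha )  <->  (alpha, u, v). *)
Definition coords0 a : 'rV[F]_7 :=
  row_mx (oul a)%:M (row_mx (our a) (odl a)) : 'rV[F]_(1 + (3 + 3)).

Definition oct0 (x : 'rV[F]_7) : O :=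
  let x' : 'rV[F]_(1 + (3 + 3)) := x in
  zorn (lsubmx x' 0 0) (lsubmx (rsubmx x')) (rsubmx (rsubmx x'))
       (- lsubmx x' 0 0).

Lemma otrace_oct0 x : otrace (oct0 x) = 0.
Proof. exact: subrr. Qed.

Lemma oct0K : cancel oct0 coords0.
Proof.
move=> x; rewrite /coords0 /oct0 /zorn /oul /our /odl /= -mx11_scalar.
by rewrite !hsubmxK.
Qed.

Lemma coords0K a : otrace a = 0 -> oct0 (coords0 a) = a.
Proof.
move=> /eqP; rewrite /otrace addrC addr_eq0 => /eqP.
case: a => [[[al u] v] be]; rewrite /odr /oul /= => ->.
by rewrite /oct0 /coords0 /zorn /= !row_mxKr !row_mxKl mxE eqxx.
Qed.

Fact coords0_is_linear : linear coords0.
Proof.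
suff: linear (coords0 : O -> 'rV[F]_(1 + (3 + 3))) by [].
move=> c a b; rewrite /coords0 !scale_row_mx !add_row_mx.
by congr (row_mx _ _); rewrite scale_scalar_mx -raddfD.
Qed.
HB.instance Definition _ :=
  GRing.isLinear.Build F O 'rV[F]_7 _ coords0 coords0_is_linear.

Fact oct0_is_linear : linear oct0.
Proof.
move=> c x y; rewrite /oct0 /=.
by congr (_, _, _, _); rewrite /= ?linearP //= !mxE // /GRing.scale /=; ring.
Qed.
HB.instance Definition _ :=
  GRing.isLinear.Build F 'rV[F]_7 O _ oct0 oct0_is_linear.

(* The matrix, acting on row vectors, of g restricted to the traceless
   octonions. *)
Definition octAut_mx (g : octAut) : 'M[F]_7 :=
  lin1_mx (coords0 \o g \o oct0).

Lemma octAut_mxE g a :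
  otrace a = 0 -> coords0 a *m octAut_mx g = coords0 (g a).
Proof. by move=> a0; rewrite mul_rV_lin1 /= coords0K. Qed.

Lemma octAut_mxV g : octAut_mx g *m octAut_mx (octAutV g) = 1%:M.
Proof.
apply/row_matrixP => i; rewrite row_mul rowE row1.
set x := delta_mx _ _; rewrite -[in LHS](oct0K x).
have g0 : otrace (g (oct0 x)) = 0 by rewrite otrace_octAut otrace_oct0.
rewrite (octAut_mxE g (otrace_oct0 x)) (octAut_mxE (octAutV g) g0) /=.
by rewrite (lker0_lfunK (octAut_lker0 g)) oct0K.
Qed.

End Octonions.

Definition frac_map (R S : idomainType) (phi : R -> S) (x : {fraction R}) :
    {fraction S} :=
  (phi \n_(repr x))%:F / (phi \d_(repr x))%:F.

Lemma frac_numden (R : idomainType) (x : {fraction R}) :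
  x = (\n_(repr x))%:F / (\d_(repr x))%:F.
Proof.
have d0 : (\d_(repr x))%:F != 0 :> {fraction R}.
  by rewrite tofrac_eq0 denom_ratioP.
apply: (mulIf d0); rewrite divfK // -{1}[x]reprK.
case: (repr x) => -[p q] /= q0; unlock FracField.tofrac.
rewrite -[LHS]FracField.pi_mul; apply/eqmodP => /=.
rewrite FracField.equivfE /FracField.mulf /=.
by rewrite !numden_Ratio ?mulf_neq0 ?oner_eq0 // !mulr1 mulrC.
Qed.

Lemma frac_mapE (R S : idomainType) (phi : {rmorphism R -> S}) (p q : R) :
  injective phi -> q != 0 ->
  frac_map phi (p%:F / q%:F) = (phi p)%:F / (phi q)%:F.
Proof.
move=> phi_inj q0; rewrite /frac_map.
have := frac_numden (p%:F / q%:F); set x := p%:F / q%:F; rewrite {1}/x.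
have : \d_(repr x) != 0 by rewrite denom_ratioP.
move: (\n_(repr x)) (\d_(repr x)) => m d d0.
have phi0 (r : R) : r != 0 -> (phi r)%:F != 0.
  by rewrite tofrac_eq0 -(inj_eq phi_inj) rmorph0.
have frac0 (r : R) : r != 0 -> r%:F != 0 by rewrite tofrac_eq0.
move/eqP; rewrite eqr_div ?frac0 // -!tofracM tofrac_eq => /eqP E.
apply/eqP; rewrite eqr_div ?phi0 // -!tofracM -!rmorphM tofrac_eq.
by rewrite E.
Qed.

Lemma comp_mpolyA (R : comNzRingType) (m k l : nat)
    (s : m.-tuple {mpoly R[k]}) (t : k.-tuple {mpoly R[l]}) (f : {mpoly R[m]}) :
  (f \mPo s) \mPo t = f \mPo [tuple tnth s i \mPo t | i < m].
Proof.
rewrite [f \mPo s]comp_mpolyEX [RHS]comp_mpolyEX raddf_sum /=.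
apply: eq_bigr => e _.
rewrite comp_mpolyZ !comp_mpolyX rmorph_prod /=; congr (_ *: _).
by apply: eq_bigr => i _; rewrite rmorphXn /= tnth_mktuple.
Qed.

Section Action.
Variables (F : fieldType) (n : nat).

(* F[O_0^n]: the variable of index mxvec_index i k is the k-th coordinate of
   the i-th traceless octonion. *)
Local Notation polyO0 := {mpoly F[n * 7]}.

Local Notation ratO0 := {fraction polyO0}.

Definition const_ratO0 : {rmorphism F -> ratO0} :=
  (@FracField.tofrac polyO0 \o @mpolyC (n * 7) F).

(* The evaluation point associated with an n-tuple of traceless octonions. *)
Definition point0 (w : 'I_n -> octonion F) : 'I_(n * 7) -> F :=
  mxvec (\matrix_(i < n) coords0 (w i)) 0.

Definition generic_point0 : 'M[polyO0]_(n, 7) := vec_mx (\row_r 'X_r).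

Lemma generic_point0E i k : generic_point0 i k = 'X_(mxvec_index i k).
Proof. by rewrite !mxE. Qed.

(* The substitution sending the i-th generic row x to x *m A. *)
Definition subst_polyO0 (A : 'M[F]_7) (f : polyO0) : polyO0 :=
  f \mPo [tuple mxvec (generic_point0 *m map_mx (@mpolyC (n * 7) F) A) 0 r
          | r < n * 7].

(* g acts by (g f)(w) = f(g^-1 w), see act_polyO0E. *)
Definition act_polyO0 (g : octAut F) : polyO0 -> polyO0 :=
  subst_polyO0 (octAut_mx (octAutV g)).

Lemma act_polyO0E (g : octAut F) (f : polyO0) (w : 'I_n -> octonion F) :
  (forall i, otrace (w i) = 0) ->
  (act_polyO0 g f).@[point0 w] = f.@[point0 (fun i => octAutV g (w i))].
Proof.
move=> w0; rewrite comp_mpoly_meval; apply: meval_eq => r.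
case/mxvec_indexP: r => i k.
rewrite tnth_mktuple /point0 !mxvecE [in LHS]mxE raddf_sum [RHS]mxE.
rewrite -octAut_mxE // [RHS]mxE /=.
apply: eq_bigr => j _.
rewrite mevalM generic_point0E mevalXU mxvecE [X in X * _ = _]mxE.
by congr (_ * _); rewrite mxE mevalC.
Qed.

Lemma subst_polyO0M A B f :
  subst_polyO0 B (subst_polyO0 A f) = subst_polyO0 (B *m A) f.
Proof.
rewrite [LHS]comp_mpolyA; congr (_ \mPo _); apply: eq_from_tnth => r.
rewrite map_mxM mulmxA; case/mxvec_indexP: r => i k.
rewrite [LHS]tnth_mktuple [RHS]tnth_mktuple tnth_mktuple.
rewrite [RHS]mxvecE [mxvec _ _ _]mxvecE [(generic_point0 *m _) i k]mxE [RHS]mxE.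
rewrite raddf_sum; apply: eq_bigr => j _ /=.
rewrite rmorphM /= generic_point0E [X in _ * (X \mPo _)]mxE comp_mpolyC.
by rewrite comp_mpolyXU -tnth_nth tnth_mktuple mxvecE [X in _ = _ * X]mxE.
Qed.

Lemma subst_polyO01 f : subst_polyO0 1%:M f = f.
Proof.
rewrite -[RHS]comp_mpoly_id; congr (_ \mPo _).
apply: eq_from_tnth => r; rewrite !tnth_mktuple.
have -> : map_mx (@mpolyC (n * 7) F) 1%:M = 1%:M by exact: map_mx1.
by rewrite mulmx1 vec_mxK mxE.
Qed.

Lemma act_polyO0_inj (g : octAut F) : injective (act_polyO0 g).
Proof.
apply: (can_inj (g := subst_polyO0 (octAut_mx g))) => f.
by rewrite subst_polyO0M octAut_mxV subst_polyO01.
Qed.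

Definition act_ratO0 (g : octAut F) : ratO0 -> ratO0 :=
  frac_map (act_polyO0 g).

Lemma act_ratO0E (g : octAut F) (p q : polyO0) : q != 0 ->
  act_ratO0 g (p%:F / q%:F) = (act_polyO0 g p)%:F / (act_polyO0 g q)%:F.
Proof.
exact: (@frac_mapE polyO0 polyO0 (comp_mpoly _) p q (@act_polyO0_inj g)).
Qed.

Definition invariant_ratO0 (f : ratO0) : Prop :=
  forall g : octAut F, act_ratO0 g f = f.

End Action.

(* Main.v *)
Require Import Defs.
From HB Require Import structures.
From Stdlib Require Classical_Prop.
From mathcomp Require Import all_boot all_order all_algebra.
From mathcomp Require Import fieldext.
From mathcomp Require Import mpoly ring.

Set Implicit Arguments.
Unset Strict Implicit.
Unset Printing Implicit Defensive.

Import GRing.Theory.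
Local Open Scope ring_scope.

(** Write n = 3 + m, let z = (z_1, ..., z_n) be the generic tuple, with entries
    in L = F(O_0^n), and let K be the field generated over F by the traces of
    products collected in [invs]: t(z_i z_j) for i, j <= 3 and t(z_1 (z_2 z_3)),
    and for every further z_l its seven traces against z_1, z_2, z_3, z_1 z_2,
    z_1 z_3, z_2 z_3 and z_1 (z_2 z_3).  These 7 + 7m = 7n - 14 polynomials are
    invariant; the point is that they generate all rational invariants.

    The group G = Aut(O) contains SL_3, acting on the upper vectors and
    contragrediently on the lower ones; over an extension M of L containing a
    square root al of t(z_1 z_1) / 2, it moves z to a tuple with
        z_1 = (al; 0; 0), z_2 = (a2; e_1; (p, q, 0)), z_3 = (a3; e_2; (r, s, 0)),
    where (alpha; u; v) lists the diagonal entry, the upper and the lower vector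
    ([reduce_to_sect]).  First z_1 is made diagonal by two unipotent elements,
    then SL_3, its stabilizer, normalizes u_2, u_3 and the product of v_2 and
    v_3.  Since p s - q r is not zero, such a tuple is a rational function
    [sect al y] of al and of the values y of the invariants ([sect_invs]).

    Only rational points of G act in the hypothesis, whereas the element g moving
    z has coordinates in M.  But g lies in the Zariski closure over M of G(F)
    ([aut_closure]): it is a product of elements of one-parameter groups, and F
    is infinite.  So if f = P / Q is invariant then f Q(z g) = P(z g), and even
    f Q(z g h) = P(z g h) for h in G(F), where h can be chosen so that the factor
    Q(z g h) is not zero.  As z g = [sect al y], this gives f in K(al).

    This normal form is defined over K(al), not over K; but al^2 lies in K and
    - al is as good a square root as al.  Replacing al by - al replaces
    P(z g h) and Q(z g h) by their conjugates over K and does not change f;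
    hence f lies in K ([conj_pair_quotient]).

    Finally the invariants are algebraically independent because [sect] produces,
    over the infinite field F, tuples with arbitrary generic values of the
    invariants, except that the first one must be twice a square
    ([gen_inv_indep]). *)

(** * Polynomials over infinite fields *)

Lemma infinite_uniq_seq (F : fieldType) (k : nat) :
  infinite_field F -> exists2 s : seq F, uniq s & size s = k.
Proof.
move=> F_inf; elim: k => [|k [s us ss]]; first by exists [::].
by have [x xs] := F_inf s; exists (x :: s); rewrite /= ?xs ?ss.
Qed.

Lemma poly_eq0_infinite (F : fieldType) (E : idomainType)
    (f : {rmorphism F -> E}) (h : {poly E}) :
  infinite_field F -> (forall c, h.[f c] = 0) -> h = 0.
Proof.
move=> F_inf hc; apply/eqP/negPn/negP => h0.
have [s us ss] := infinite_uniq_seq (size h) F_inf.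
have us' : uniq (map f s) by rewrite map_inj_uniq //; exact: fmorph_inj.
have rs : all (root h) (map f s).
  by apply/allP => _ /mapP [c _ ->]; apply/rootP.
by have := max_poly_roots h0 rs us'; rewrite size_map ss ltnn.
Qed.

Lemma poly_eq0_squares (F : fieldType) (h : {poly F}) (c : F) :
  infinite_field F -> c != 0 -> (forall t, h.[c * t ^+ 2] = 0) -> h = 0.
Proof.
move=> F_inf c0 ht.
have : h \Po (c *: 'X^2) = 0.
  apply: (poly_eq0_infinite (f := idfun)) => // t.
  by rewrite horner_comp hornerZ hornerXn ht.
move/eqP; rewrite comp_poly_eq0 => [/eqP //|].
by rewrite size_scale // size_polyXn.
Qed.

Lemma rmorph_mmap (d : nat) (K : nzRingType) (R S : comNzRingType)
    (f : {rmorphism K -> R}) (g : {rmorphism R -> S}) (h : 'I_d -> R)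
    (p : {mpoly K[d]}) :
  g (mmap f h p) = mmap (g \o f) (g \o h) p.
Proof.
rewrite /mmap rmorph_sum; apply: eq_bigr => e _ /=.
rewrite rmorphM /mmap1 rmorph_prod; congr (_ * _).
by apply: eq_bigr => i _; rewrite rmorphXn.
Qed.

Lemma eq_mmap (d : nat) (K R : nzRingType) (f g : K -> R) (h k : 'I_d -> R)
    (p : {mpoly K[d]}) :
  f =1 g -> h =1 k -> mmap f h p = mmap g k p.
Proof.
move=> fg hk; rewrite /mmap; apply: eq_bigr => e _.
by rewrite fg (mmap1_eq _ hk).
Qed.

Lemma meval_mmap (d : nat) (R : comNzRingType) (v : 'I_d -> R)
    (p : {mpoly R[d]}) : p.@[v] = mmap idfun v p.
Proof. by rewrite /meval; apply: eq_mmap. Qed.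

Lemma horner_mmap (d : nat) (K : nzRingType) (R : comNzRingType)
    (f : {rmorphism K -> R}) (h : 'I_d -> {poly R}) (p : {mpoly K[d]}) (t : R) :
  (mmap (polyC \o f) h p).[t] = mmap f (fun i => (h i).[t]) p.
Proof.
rewrite -[LHS]/(horner_eval t _) rmorph_mmap.
by apply: eq_mmap => c //=; rewrite /horner_eval hornerC.
Qed.

(** Replace the coordinates of the point by the variables one at a time; each
    replacement only needs the statement in one variable. *)
Lemma mpoly_eq0_infinite (F : fieldType) (d : nat) (p : {mpoly F[d]}) :
  infinite_field F -> (forall v, p.@[v] = 0) -> p = 0.
Proof.
move=> F_inf pv.
pose C : {rmorphism F -> {mpoly F[d]}} := @mpolyC d F.
pose hyb k (v : 'I_d -> F) (i : 'I_d) : {mpoly F[d]} :=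
  if (i < k)%N then 'X_i else C (v i).
have hyb0 k v : mmap C (hyb k v) p = 0.
  elim: k v => [|k IH] v.
    have <- : (p.@[v])%:MP = mmap C (hyb 0%N v) p.
      rewrite meval_mmap -[LHS]/(C _) rmorph_mmap.
      by apply: eq_mmap => // i; rewrite /hyb ltn0.
    by rewrite pv mpolyC0.
  case: (ltnP k d) => [kd|dk]; last first.
    rewrite -[RHS](IH v); apply: eq_mmap => // i.
    by rewrite /hyb !(leq_trans (ltn_ord i)) // leqW.
  pose h (i : 'I_d) : {poly {mpoly F[d]}} :=
    if val i == k then 'X else (hyb k v i)%:P.
  have h0 : mmap (polyC \o C) h p = 0.
    apply: (poly_eq0_infinite (f := C)) => // c.
    rewrite horner_mmap.
    rewrite -[RHS](IH (fun i => if val i == k then c else v i)).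
    apply: eq_mmap => // i; rewrite /h /hyb; case: eqP => [->|_].
      by rewrite ltnn hornerX.
    by rewrite hornerC.
  have := congr1 (horner^~ 'X_(Ordinal kd)) h0.
  rewrite horner_mmap horner0 => E; rewrite -[RHS]E.
  apply: eq_mmap => // i; rewrite /h /hyb ltnS leq_eqVlt.
  case: eqP => [e|_] /=; last by rewrite hornerC.
  by rewrite hornerX; congr 'X_ _; apply: val_inj.
have := hyb0 d (fun=> 0); rewrite -[X in _ -> X = _]comp_mpoly_id.
rewrite /comp_mpoly => E; rewrite -[RHS]E.
by apply: eq_mmap => // i; rewrite tnth_mktuple /hyb ltn_ord.
Qed.

(** * Adjoining a square root *)

(** The extension may be trivial, so that nothing has to be known about [a]. *)
Lemma sqrt_extension (L : fieldType) (a : L) :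
  exists (M : fieldType) (j : {rmorphism L -> M}) (al : M), al ^+ 2 = j a.
Proof.
pose p : {poly L} := 'X^2 - a%:P.
have sp : size p = 3%N by rewrite size_XnsubC.
have [[x px]|nx] := Classical_Prop.classic (exists x, root p x).
  exists L, idfun, x; move/rootP: px.
  by rewrite !hornerE => /eqP; rewrite subr_eq0 => /eqP.
have irr : irreducible_poly p.
  by apply: cubic_irreducible => [|x]; [rewrite sp | apply/negP => px; apply: nx; exists x].
have [M _ [al ra _]] := irredp_FAdjoin irr.
exists M, (in_alg M), al; move/rootP: ra.
by rewrite rmorphB /= map_polyXn map_polyC !hornerE => /eqP; rewrite subr_eq0 => /eqP.
Qed.

(** * Trace forms on traceless octonions *)

Section TraceForms.
Variable R : comNzRingType.
Implicit Types (a b c x y z w : nat -> R).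

Definition dot3 a b : R := a 0%N * b 0%N + a 1%N * b 1%N + a 2%N * b 2%N.

Definition cross3 a b : nat -> R :=
  nth 0 [:: a 1%N * b 2%N - a 2%N * b 1%N; a 2%N * b 0%N - a 0%N * b 2%N;
            a 0%N * b 1%N - a 1%N * b 0%N].

Definition upper x : nat -> R := fun i => x i.+1.
Definition lower x : nat -> R := fun i => x i.+4.

(** The coordinates [x] stand for the traceless octonion of diagonal [x 0],
    [- x 0] and off-diagonal vectors [upper x] and [lower x].  The forms below
    are the traces of x y, of z (x y) and of w (x (y z)), written out so that
    they make sense over a polynomial ring. *)
Definition form2 x y : R :=
  2%:R * x 0%N * y 0%N + dot3 (upper x) (lower y) + dot3 (lower x) (upper y).

Definition form3 x y z : R :=
  z 0%N * (dot3 (upper x) (lower y) - dot3 (lower x) (upper y))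
  + y 0%N * (dot3 (upper z) (lower x) - dot3 (lower z) (upper x))
  + x 0%N * (dot3 (lower z) (upper y) - dot3 (upper z) (lower y))
  + dot3 (upper z) (cross3 (upper x) (upper y))
  - dot3 (lower z) (cross3 (lower x) (lower y)).

Definition form4 x y z w : R :=
  let A := y 0%N * z 0%N + dot3 (upper y) (lower z) in
  let B := y 0%N * z 0%N + dot3 (lower y) (upper z) in
  let U i := y 0%N * upper z i - z 0%N * upper y i
             - cross3 (lower y) (lower z) i in
  let V i := z 0%N * lower y i - y 0%N * lower z i
             + cross3 (upper y) (upper z) i in
  w 0%N * x 0%N * (A + B) + w 0%N * (dot3 (upper x) V - dot3 (lower x) U)
  + A * dot3 (upper w) (lower x) + B * dot3 (lower w) (upper x)
  + x 0%N * (dot3 (lower w) U - dot3 (upper w) V)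
  + dot3 (upper w) (cross3 (upper x) U) - dot3 (lower w) (cross3 (lower x) V).

Definition crd (x : 'rV[R]_7) : nat -> R := fun k => x 0 (inord k).

End TraceForms.

Section TraceFormsOct.
Variable F : fieldType.
Implicit Types (x y z w : 'rV[F]_7) (a b : octonion F).

Lemma oul_oct0 x : oul (oct0 x) = crd x 0%N.
Proof.
rewrite /oct0 /oul /zorn /= mxE; congr (x 0 _); apply: val_inj.
by rewrite /= inordK.
Qed.

Lemma our_oct0 x (i : 'I_3) : our (oct0 x) 0 i = crd x i.+1.
Proof.
rewrite /oct0 /our /zorn /= !mxE; congr (x 0 _); apply: val_inj.
by rewrite /= inordK //; case: i => [[|[|[|]]]].
Qed.

Lemma odl_oct0 x (i : 'I_3) : odl (oct0 x) 0 i = crd x i.+4.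
Proof.
rewrite /oct0 /odl /zorn /= !mxE; congr (x 0 _); apply: val_inj.
by rewrite /= inordK //; case: i => [[|[|[|]]]].
Qed.

Lemma odr_oct0 x : odr (oct0 x) = - crd x 0%N.
Proof. by rewrite -oul_oct0. Qed.

(** Together with [ord3_add] this turns identities between octonions into
    polynomial identities between their eight coordinates. *)
Lemma sum_ord3 (V : nmodType) (f : 'I_3 -> V) :
  \sum_i f i = f 0 + f 1 + f 2%:R.
Proof.
by rewrite !big_ord_recr big_ord0 /= add0r; congr (f _ + f _ + f _); apply: val_inj.
Qed.

Lemma ord3_add :
  [/\ 1 + 1 = 2%:R :> 'I_3, 1 + 2%:R = 0 :> 'I_3,
      2%:R + 1 = 0 :> 'I_3 & 2%:R + 2%:R = 1 :> 'I_3].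
Proof. by split; apply: val_inj. Qed.

Lemma oul_mul a b : oul (omul a b) = oul a * oul b + dotv (our a) (odl b).
Proof. by []. Qed.

Lemma odr_mul a b : odr (omul a b) = odr a * odr b + dotv (odl a) (our b).
Proof. by []. Qed.

Lemma our_mul a b i : our (omul a b) 0 i =
  oul a * our b 0 i + odr b * our a 0 i
  - (odl a 0 (i + 1) * odl b 0 (i + 2%:R)
     - odl a 0 (i + 2%:R) * odl b 0 (i + 1)).
Proof. by rewrite {1}/our /= !mxE. Qed.

Lemma odl_mul a b i : odl (omul a b) 0 i =
  oul b * odl a 0 i + odr a * odl b 0 i
  + (our a 0 (i + 1) * our b 0 (i + 2%:R)
     - our a 0 (i + 2%:R) * our b 0 (i + 1)).
Proof. by rewrite {1}/odl /= !mxE. Qed.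

Definition omulE := (oul_mul, odr_mul, our_mul, odl_mul).
Definition oct0E := (oul_oct0, odr_oct0, our_oct0, odl_oct0).

Lemma otrace_mul2 x y :
  otrace (omul (oct0 x) (oct0 y)) = form2 (crd x) (crd y).
Proof.
case: ord3_add => e11 e12 e21 e22.
rewrite /otrace !omulE /dotv !sum_ord3 !oct0E.
rewrite /form2 /dot3 /upper /lower /=; ring.
Qed.

Lemma otrace_mul3 x y z :
  otrace (omul (oct0 z) (omul (oct0 x) (oct0 y)))
  = form3 (crd x) (crd y) (crd z).
Proof.
case: ord3_add => e11 e12 e21 e22.
rewrite /otrace !omulE /dotv !sum_ord3 !omulE !(add0r, e11, e12, e21, e22).
rewrite !oct0E /form3 /dot3 /cross3 /upper /lower /=; ring.
Qed.

Lemma otrace_mul4 x y z w :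
  otrace (omul (oct0 w) (omul (oct0 x) (omul (oct0 y) (oct0 z))))
  = form4 (crd x) (crd y) (crd z) (crd w).
Proof.
case: ord3_add => e11 e12 e21 e22.
rewrite /otrace !omulE /dotv !sum_ord3 !omulE !(add0r, e11, e12, e21, e22).
rewrite /dotv !sum_ord3 !oct0E /form4 /dot3 /cross3 /upper /lower /=; ring.
Qed.

Lemma oct0_octAut (g : octAut F) x : oct0 (x *m octAut_mx g) = g (oct0 x).
Proof.
rewrite -[x in LHS]oct0K octAut_mxE ?otrace_oct0 // coords0K //.
by rewrite otrace_octAut otrace_oct0.
Qed.

Lemma form2_octAut (g : octAut F) x y :
  form2 (crd (x *m octAut_mx g)) (crd (y *m octAut_mx g))
  = form2 (crd x) (crd y).
Proof. by rewrite -!otrace_mul2 !oct0_octAut -octAutM otrace_octAut. Qed.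

Lemma form3_octAut (g : octAut F) x y z :
  form3 (crd (x *m octAut_mx g)) (crd (y *m octAut_mx g))
        (crd (z *m octAut_mx g))
  = form3 (crd x) (crd y) (crd z).
Proof. by rewrite -!otrace_mul3 !oct0_octAut -!octAutM otrace_octAut. Qed.

Lemma form4_octAut (g : octAut F) x y z w :
  form4 (crd (x *m octAut_mx g)) (crd (y *m octAut_mx g))
        (crd (z *m octAut_mx g)) (crd (w *m octAut_mx g))
  = form4 (crd x) (crd y) (crd z) (crd w).
Proof. by rewrite -!otrace_mul4 !oct0_octAut -!octAutM otrace_octAut. Qed.
End TraceFormsOct.

(** * Some automorphisms of the octonions *)

Section Matrices.
Variable R : comNzRingType.

Definition seqmx7 (s : seq (seq R)) : 'M[R]_7 :=
  \matrix_(i, j) nth 0 (nth [::] s i) j.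

Lemma sum_inord (d : nat) (V : nmodType) (f : 'I_d.+1 -> V) :
  \sum_i f i = \sum_(0 <= k < d.+1) f (inord k).
Proof. by rewrite big_mkord; apply: eq_bigr => i _; rewrite inord_val. Qed.

Lemma crd_seqmx7 (x : 'rV[R]_7) (s : seq (seq R)) (k : nat) : (k < 7)%N ->
  crd (x *m seqmx7 s) k
  = \sum_(0 <= j < 7) crd x j * nth 0 (nth [::] s j) k.
Proof.
move=> k7; rewrite /crd mxE sum_inord.
by apply: eq_big_nat => j /andP [_ j7]; rewrite mxE !inordK.
Qed.

Lemma crd_inj (x y : 'rV[R]_7) :
  (forall k, (k < 7)%N -> crd x k = crd y k) -> x = y.
Proof. by move=> xy; apply/rowP => i; have := xy i (ltn_ord i); rewrite /crd inord_val. Qed.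

Lemma mulmx_row_inj (p q : nat) (A B : 'M[R]_(p, q)) :
  (forall x : 'rV_p, x *m A = x *m B) -> A = B.
Proof. by move=> AB; apply/row_matrixP => i; rewrite !rowE AB. Qed.

(** The automorphism that adds the upper vector w = (a, b, c) to the idempotent
    of diagonal (1, 0).  It sends (alpha; u; v) to
    (alpha - w.v; u + (2 alpha - w.v) w; v + w x u). *)
Definition upper_unip (a b c : R) : 'M[R]_7 := seqmx7
  [:: [:: 1; a *+ 2; b *+ 2; c *+ 2; 0; 0; 0];
      [:: 0; 1; 0; 0; 0; c; - b];
      [:: 0; 0; 1; 0; - c; 0; a];
      [:: 0; 0; 0; 1; b; - a; 0];
      [:: - a; - (a * a); - (a * b); - (a * c); 1; 0; 0];
      [:: - b; - (b * a); - (b * b); - (b * c); 0; 1; 0];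
      [:: - c; - (c * a); - (c * b); - (c * c); 0; 0; 1]].

(** It exchanges the two diagonal idempotents, so that conjugating [upper_unip]
    by it gives the analogous automorphisms for the lower vectors. *)
Definition swap_mx : 'M[R]_7 := seqmx7
  [:: [:: -1; 0; 0; 0; 0; 0; 0];
      [:: 0; 0; 0; 0; -1; 0; 0];
      [:: 0; 0; 0; 0; 0; -1; 0];
      [:: 0; 0; 0; 0; 0; 0; -1];
      [:: 0; -1; 0; 0; 0; 0; 0];
      [:: 0; 0; -1; 0; 0; 0; 0];
      [:: 0; 0; 0; -1; 0; 0; 0]].

Lemma crd_upper_unip x a b c k : (k < 7)%N ->
  crd (x *m upper_unip a b c) k =
  let X := crd x in
  let w := nth 0 [:: a; b; c] in
  let s := dot3 w (lower X) in
  nth 0 [:: X 0%N - s;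
            X 1%N + (X 0%N *+ 2 - s) * a; X 2%N + (X 0%N *+ 2 - s) * b;
            X 3%N + (X 0%N *+ 2 - s) * c;
            X 4%N + cross3 w (upper X) 0%N; X 5%N + cross3 w (upper X) 1%N;
            X 6%N + cross3 w (upper X) 2%N] k.
Proof.
move=> k7; rewrite crd_seqmx7 // unlock /=.
rewrite /dot3 /cross3 /upper /lower /=.
by case: k k7 => [|[|[|[|[|[|[|]]]]]]] //= _; ring.
Qed.

Lemma crd_swap x k : (k < 7)%N ->
  crd (x *m swap_mx) k = - nth 0 [seq crd x i | i <- [:: 0; 4; 5; 6; 1; 2; 3]%N] k.
Proof.
move=> k7; rewrite crd_seqmx7 // unlock /=.
by case: k k7 => [|[|[|[|[|[|[|]]]]]]] //= _; ring.
Qed.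

Lemma upper_unipK a b c : upper_unip a b c *m upper_unip (- a) (- b) (- c) = 1%:M.
Proof.
apply: mulmx_row_inj => x; apply: crd_inj => k k7.
rewrite mulmxA mulmx1 crd_upper_unip //= /dot3 /cross3 /upper /lower /=.
rewrite !crd_upper_unip //= /dot3 /cross3 /upper /lower /=.
by case: k k7 => [|[|[|[|[|[|[|]]]]]]] //= _; ring.
Qed.

Lemma swap_mxK : swap_mx *m swap_mx = 1%:M.
Proof.
apply: mulmx_row_inj => x; apply: crd_inj => k k7.
rewrite mulmxA mulmx1 crd_swap //=.
by case: k k7 => [|[|[|[|[|[|[|]]]]]]] //= _; rewrite crd_swap //= opprK.
Qed.

(** An element of SL_3 is given by the pair of [A] and its contragredient [B],
    so that no inverse is needed over a polynomial ring. *)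
Definition sl3_mx (A B : 'M[R]_3) : 'M[R]_7 :=
  block_mx 1%:M 0 0 (block_mx A 0 0 B) : 'M_(1 + (3 + 3)).

Lemma sl3_mxM A B A' B' :
  sl3_mx A B *m sl3_mx A' B' = sl3_mx (A *m A') (B *m B').
Proof.
rewrite /sl3_mx (@mulmx_block R 1 (3 + 3) 1 (3 + 3) 1 (3 + 3)).
rewrite !(mulmx0, mul0mx, mulmx1, mul1mx, addr0, add0r).
by rewrite mulmx_block !(mulmx0, mul0mx, addr0, add0r).
Qed.

Lemma sl3_mx1 : sl3_mx 1%:M 1%:M = 1%:M.
Proof. by rewrite /sl3_mx -!(@scalar_mx_block R). Qed.

Definition elem_mx (i j : 'I_3) (t : R) : 'M[R]_3 := 1%:M + t *: delta_mx i j.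

Lemma elem_mxE (p : nat) (U : 'M[R]_(p, 3)) i j t l k :
  (U *m elem_mx i j t) l k = U l k + (k == j)%:R * (t * U l i).
Proof.
rewrite mulmxDr mulmx1 mxE -scalemxAr mxE; congr (_ + _).
rewrite mxE (bigD1 i) //= mxE eqxx big1 /= => [|i' i'i].
  by rewrite addr0; ring.
by rewrite mxE (negPf i'i) mulr0.
Qed.

Lemma elem_mxM i j s t :
  i != j -> elem_mx i j s *m elem_mx i j t = elem_mx i j (s + t).
Proof.
move=> ij; apply/matrixP => l k; rewrite elem_mxE !mxE (negPf ij) andbF.
by case: (l == i); case: (k == j) => /=; ring.
Qed.

Lemma elem_mx0 i j : elem_mx i j 0 = 1%:M.
Proof. by rewrite /elem_mx scale0r addr0. Qed.

End Matrices.

Section Automorphisms.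
Variable F : fieldType.
Local Notation O := (octonion F).
Implicit Types (a b : O) (u v w : 'rV[F]_3).

Definition aut_mx (k : 'M[F]_7) : Prop := exists g : octAut F, k = octAut_mx g.

Lemma oct_ext a b :
  oul a = oul b -> our a = our b -> odl a = odl b -> odr a = odr b -> a = b.
Proof. by move: a b => [[[? ?] ?] ?] [[[? ?] ?] ?]; rewrite /oul /our /odl /odr /= => -> -> -> ->. Qed.

(** Linearity is a hypothesis on a bare function: the automorphisms below are
    given by formulas. *)
Lemma octAut_exists (f h : O -> O) :
  linear f -> {morph f : a b / omul a b} -> cancel f h -> cancel h f ->
  exists g : octAut F, g =1 f.
Proof.
move=> flin fM fK hK.
pose fL : {linear O -> O} := HB.pack f (GRing.isLinear.Build F O O _ f flin).
have lE : linfun fL =1 f by exact: lfunE.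
have gM : {morph linfun fL : a b / omul a b} by move=> a b; rewrite !lE fM.
have gB : bijective (linfun fL) by apply: (eq_bij (f := f)); [exists h|].
by exists (OctAut gM gB).
Qed.

Lemma octAut_mx_eq (g : octAut F) (k : 'M[F]_7) :
  (forall x, oct0 (x *m k) = g (oct0 x)) -> octAut_mx g = k.
Proof.
move=> gk; apply: mulmx_row_inj => x; apply: (can_inj (@oct0K F)).
by rewrite oct0_octAut gk.
Qed.

Lemma aut_mxM k l : aut_mx k -> aut_mx l -> aut_mx (k *m l).
Proof.
move=> [g ->] [h ->].
have [f fE] : exists f : octAut F, f =1 h \o g.
  have [g' gK g'K] := octAut_bij g; have [h' hK h'K] := octAut_bij h.
  apply: (@octAut_exists _ (g' \o h')).
  - by move=> c a b /=; rewrite !linearP.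
  - by move=> a b /=; rewrite !octAutM.
  - exact: can_comp hK gK.
  - exact: can_comp g'K h'K.
exists f; apply/esym/octAut_mx_eq => x.
by rewrite fE /= mulmxA !oct0_octAut.
Qed.

Lemma octAutVV_mx (g : octAut F) : octAut_mx (octAutV (octAutV g)) = octAut_mx g.
Proof.
rewrite -[RHS]mulmx1 -(octAut_mxV (octAutV g)) mulmxA octAut_mxV.
by rewrite mul1mx.
Qed.

Lemma oct0_eq (x : 'rV[F]_7) a :
  otrace a = 0 -> crd x 0%N = oul a ->
  (forall i : 'I_3, crd x i.+1 = our a 0 i) ->
  (forall i : 'I_3, crd x i.+4 = odl a 0 i) -> oct0 x = a.
Proof.
move=> /eqP; rewrite /otrace addrC addr_eq0 => /eqP ta x0 xu xd.
apply: oct_ext; first by rewrite oul_oct0.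
- by apply/rowP => i; rewrite our_oct0.
- by apply/rowP => i; rewrite odl_oct0.
- by rewrite odr_oct0 x0 ta.
Qed.

Lemma ord3_ind (P : 'I_3 -> Prop) : P 0 -> P 1 -> P 2%:R -> forall i, P i.
Proof.
move=> P0 P1 P2 [[|[|[|//]]] i].
- by rewrite (_ : Ordinal i = 0) //; apply: val_inj.
- by rewrite (_ : Ordinal i = 1) //; apply: val_inj.
- by rewrite (_ : Ordinal i = 2%:R) //; apply: val_inj.
Qed.

Definition upper_unip_fun w a : O :=
  let s := dotv w (odl a) in
  zorn (oul a - s) (our a + (oul a - odr a - s) *: w)
       (odl a + crossv w (our a)) (odr a + s).

Lemma crossvE u v i : crossv u v 0 i =
  u 0 (i + 1) * v 0 (i + 2%:R) - u 0 (i + 2%:R) * v 0 (i + 1).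
Proof. by rewrite mxE. Qed.

Lemma upper_unip_oul w a :
  oul (upper_unip_fun w a) = oul a - dotv w (odl a).
Proof. by []. Qed.

Lemma upper_unip_odr w a :
  odr (upper_unip_fun w a) = odr a + dotv w (odl a).
Proof. by []. Qed.

Lemma upper_unip_our w a i : our (upper_unip_fun w a) 0 i
  = our a 0 i + (oul a - odr a - dotv w (odl a)) * w 0 i.
Proof. by rewrite /= !mxE. Qed.

Lemma upper_unip_odl w a i : odl (upper_unip_fun w a) 0 i
  = odl a 0 i
    + (w 0 (i + 1) * our a 0 (i + 2%:R) - w 0 (i + 2%:R) * our a 0 (i + 1)).
Proof. by rewrite /= !mxE. Qed.

Let unipE := (upper_unip_oul, upper_unip_odr, upper_unip_our, upper_unip_odl).

Let octD c a b : [/\ oul (c *: a + b) = c * oul a + oul b,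
   odr (c *: a + b) = c * odr a + odr b,
   our (c *: a + b) = c *: our a + our b
   & odl (c *: a + b) = c *: odl a + odl b].
Proof. by []. Qed.

Lemma upper_unip_lin w : linear (upper_unip_fun w).
Proof.
move=> c a b; have [lE rE uE dE] := octD c a b.
have [lE' rE' uE' dE'] := octD c (upper_unip_fun w a) (upper_unip_fun w b).
apply: oct_ext; last 1 first.
all: rewrite ?(lE', rE', uE', dE'); try apply/rowP; try elim/ord3_ind.
all: rewrite ?[(_ + _) 0 _]mxE ?[(_ *: _) 0 _]mxE ?unipE !(lE, rE, uE, dE).
all: rewrite /dotv ?sum_ord3 !mxE /dotv ?sum_ord3 ?mxE; ring.
Qed.

Lemma upper_unip_mul w : {morph upper_unip_fun w : a b / omul a b}.
Proof.
case: ord3_add => e11 e12 e21 e22 a b.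
apply: oct_ext; last 1 first.
all: try apply/rowP; try elim/ord3_ind.
all: rewrite ?(omulE, unipE) ?(add0r, e11, e12, e21, e22) /dotv ?sum_ord3.
all: rewrite ?(omulE, unipE) ?(add0r, e11, e12, e21, e22) /dotv ?sum_ord3.
all: ring.
Qed.

Lemma upper_unip_funK w : cancel (upper_unip_fun w) (upper_unip_fun (- w)).
Proof.
case: ord3_add => e11 e12 e21 e22 a.
apply: oct_ext; last 1 first.
all: try apply/rowP; try elim/ord3_ind.
all: rewrite ?unipE /dotv ?sum_ord3 ?unipE ?(add0r, e11, e12, e21, e22) /dotv.
all: rewrite ?sum_ord3 ![(- w) _ _]mxE; ring.
Qed.

Lemma upper_unip_aut x1 x2 x3 : aut_mx (upper_unip x1 x2 x3).
Proof.
pose w : 'rV[F]_3 := \row_i nth 0 [:: x1; x2; x3] i.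
have [g gE] : exists g : octAut F, g =1 upper_unip_fun w.
  apply: (octAut_exists (@upper_unip_lin w) (@upper_unip_mul w)).
    exact: upper_unip_funK.
  by move=> a; rewrite -[w in upper_unip_fun w]opprK upper_unip_funK.
exists g; apply/esym/octAut_mx_eq => x; rewrite gE.
case: ord3_add => e11 e12 e21 e22.
apply: oct0_eq; first by rewrite /otrace !unipE !oct0E; ring.
all: try elim/ord3_ind; rewrite crd_upper_unip //=.
all: rewrite /dot3 /cross3 /upper /lower /=.
all: rewrite ?unipE ?(add0r, e11, e12, e21, e22) /dotv ?sum_ord3.
all: rewrite !oct0E !mxE /=; ring.
Qed.

Definition swap_fun a : O := zorn (odr a) (- odl a) (- our a) (oul a).

Lemma swap_oul a : oul (swap_fun a) = odr a. Proof. by []. Qed.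
Lemma swap_odr a : odr (swap_fun a) = oul a. Proof. by []. Qed.
Lemma swap_our a i : our (swap_fun a) 0 i = - odl a 0 i.
Proof. by rewrite [our _]/= mxE. Qed.
Lemma swap_odl a i : odl (swap_fun a) 0 i = - our a 0 i.
Proof. by rewrite [odl _]/= mxE. Qed.
Let swapE := (swap_oul, swap_odr, swap_our, swap_odl).

Lemma swap_funK : involutive swap_fun.
Proof.
by move=> [[[? ?] ?] ?]; rewrite /swap_fun /zorn /oul /our /odl /odr /= !opprK.
Qed.

Lemma swap_lin : linear swap_fun.
Proof.
move=> c a b; have [lE rE uE dE] := octD c a b.
have [lE' rE' uE' dE'] := octD c (swap_fun a) (swap_fun b).
apply: oct_ext; rewrite ?(lE', rE', uE', dE') //=.
  by rewrite scalerN -opprD.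
by rewrite scalerN -opprD.
Qed.

Lemma swap_mul : {morph swap_fun : a b / omul a b}.
Proof.
case: ord3_add => e11 e12 e21 e22 a b.
apply: oct_ext; last 1 first.
all: try apply/rowP; try elim/ord3_ind.
all: rewrite ?(omulE, swapE) ?(add0r, e11, e12, e21, e22) /dotv.
all: rewrite ?sum_ord3 ?(omulE, swapE) ?(add0r, e11, e12, e21, e22); ring.
Qed.

Lemma swap_aut : aut_mx (swap_mx F).
Proof.
have [g gE] := octAut_exists swap_lin swap_mul swap_funK swap_funK.
exists g; apply/esym/octAut_mx_eq => x; rewrite gE.
apply: oct0_eq; first by rewrite /otrace !swapE !oct0E; ring.
all: try elim/ord3_ind; rewrite crd_swap // swapE !oct0E //=.
Qed.

(** For A in SL_3 the cross product of u A and v A is the cross product of u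
    and v times the contragredient of A; transvections are enough here. *)
Lemma crossv_elem i j t u v : i != j ->
  crossv (u *m elem_mx i j t) (v *m elem_mx i j t)
  = crossv u v *m elem_mx j i (- t).
Proof.
case: ord3_add => e11 e12 e21 e22.
elim/ord3_ind: i; elim/ord3_ind: j => // _; apply/rowP; elim/ord3_ind.
all: rewrite !crossvE !elem_mxE !crossvE ?(add0r, e11, e12, e21, e22) /=.
all: ring.
Qed.

Lemma dotv_elem i j t u v : i != j ->
  dotv (u *m elem_mx i j t) (v *m elem_mx j i (- t)) = dotv u v.
Proof.
case: ord3_add => e11 e12 e21 e22.
elim/ord3_ind: i; elim/ord3_ind: j => // _.
all: rewrite /dotv !sum_ord3 !elem_mxE /=; ring.
Qed.

Lemma sl3_mx_row (al : 'rV[F]_1) u v A B :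
  (row_mx al (row_mx u v) : 'rV_(1 + (3 + 3))) *m sl3_mx A B
  = row_mx al (row_mx (u *m A) (v *m B)) :> 'rV_(1 + (3 + 3)).
Proof.
rewrite /sl3_mx (@mul_row_block F 1 1 (3 + 3) 1 (3 + 3)).
by rewrite !(mulmx0, mulmx1, addr0, add0r) mul_row_block !(mulmx0, addr0, add0r).
Qed.

Lemma oct0_row (al : 'rV[F]_1) u v :
  oct0 (row_mx al (row_mx u v) : 'rV_(1 + (3 + 3)))
  = zorn (al 0 0) u v (- al 0 0).
Proof. by rewrite /oct0 !(row_mxKl, row_mxKr). Qed.

Definition sl3_fun (A B : 'M[F]_3) a : O :=
  zorn (oul a) (our a *m A) (odl a *m B) (odr a).

Lemma oct0_sl3 (x : 'rV[F]_7) A B :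
  oct0 (x *m sl3_mx A B) = sl3_fun A B (oct0 x).
Proof.
pose x' : 'rV[F]_(1 + (3 + 3)) := x.
have -> : x = row_mx (lsubmx x')
    (row_mx (lsubmx (rsubmx x')) (rsubmx (rsubmx x'))) by rewrite !hsubmxK.
by rewrite sl3_mx_row !oct0_row.
Qed.

Lemma sl3_our A B a : our (sl3_fun A B a) = our a *m A. Proof. by []. Qed.
Lemma sl3_odl A B a : odl (sl3_fun A B a) = odl a *m B. Proof. by []. Qed.

Lemma sl3_elem_aut i j t : i != j ->
  aut_mx (sl3_mx (elem_mx i j t) (elem_mx j i (- t))).
Proof.
move=> ij; have ji : j != i by rewrite eq_sym.
have linE A B : linear (sl3_fun A B).
  move=> c a b; have [lE rE uE dE] := octD c a b.
  have [lE' rE' uE' dE'] := octD c (sl3_fun A B a) (sl3_fun A B b).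
  apply: oct_ext; rewrite ?(lE', rE', uE', dE') //.
    by rewrite !sl3_our uE mulmxDl scalemxAl.
  by rewrite !sl3_odl dE mulmxDl scalemxAl.
have mulE : {morph sl3_fun (elem_mx i j t) (elem_mx j i (- t))
             : a b / omul a b}.
  move=> a b; rewrite /sl3_fun /omul /zorn.
  rewrite /oul /our /odl /odr /= -/(oul a) -/(our a) -/(odl a) -/(odr a).
  rewrite -/(oul b) -/(our b) -/(odl b) -/(odr b).
  rewrite dotv_elem // -[X in dotv (_ *m _) (_ *m elem_mx i j X)]opprK.
  rewrite dotv_elem // crossv_elem // crossv_elem // opprK.
  by rewrite !mulmxDl mulNmx -!scalemxAl.
have KE i' j' s : i' != j' -> cancel
    (sl3_fun (elem_mx i' j' s) (elem_mx j' i' (- s)))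
    (sl3_fun (elem_mx i' j' (- s)) (elem_mx j' i' (- - s))).
  move=> ij' a; have ji' : j' != i' by rewrite eq_sym.
  by apply: oct_ext => //; rewrite ?sl3_our ?sl3_odl -mulmxA elem_mxM // subrr
    elem_mx0 mulmx1.
have [g gE] : exists g : octAut F,
    g =1 sl3_fun (elem_mx i j t) (elem_mx j i (- t)).
  apply: (octAut_exists (linE _ _) mulE (KE _ _ _ ij)).
  by have := KE i j (- t) ij; rewrite !opprK.
by exists g; apply/esym/octAut_mx_eq => x; rewrite gE oct0_sl3.
Qed.
End Automorphisms.

(** * The Zariski closure of the automorphism group over an extension field *)

Lemma mmap_subst (F M : fieldType) (io : {rmorphism F -> M}) (n : nat)
    (A : 'M[F]_7) (W : 'M[M]_(n, 7)) (h : {mpoly F[n * 7]}) :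
  mmap io (mxvec W 0) (subst_polyO0 A h)
  = mmap io (mxvec (W *m map_mx io A) 0) h.
Proof.
rewrite /subst_polyO0 /comp_mpoly.
rewrite (@rmorph_mmap _ _ _ _ _ (mmap io (mxvec W 0))).
apply: eq_mmap => [c|r] /=; first by rewrite mmapC.
case/mxvec_indexP: r => i k.
rewrite tnth_mktuple !mxvecE mxE [RHS]mxE raddf_sum /=.
apply: eq_bigr => l _.
by rewrite rmorphM generic_point0E /= mmapX mmap1U mxvecE !mxE mmapC.
Qed.

Lemma meval_subst (M : fieldType) (n : nat) (A : 'M[M]_7) (W : 'M[M]_(n, 7))
    (h : {mpoly M[n * 7]}) :
  (subst_polyO0 A h).@[mxvec W 0] = h.@[mxvec (W *m A) 0].
Proof. by rewrite !meval_mmap (mmap_subst idfun) map_mx_id. Qed.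

Section NaturalMx.
Variables (R S : comNzRingType) (f : {rmorphism R -> S}).

Lemma map_seqmx7 (s : seq (seq R)) :
  map_mx f (seqmx7 s) = seqmx7 [seq [seq f x | x <- r] | r <- s].
Proof.
apply/matrixP => i j; rewrite !mxE.
case: (ltnP i (size s)) => si; last first.
  by rewrite !(nth_default [::]) ?size_map // !nth_nil rmorph0.
rewrite (nth_map [::]) //; set r := nth [::] _ _.
case: (ltnP j (size r)) => sj; first by rewrite (nth_map 0).
by rewrite !nth_default ?size_map // rmorph0.
Qed.

Lemma map_upper_unip a b c :
  map_mx f (upper_unip a b c) = upper_unip (f a) (f b) (f c).
Proof.
by rewrite map_seqmx7 /= !(rmorph1, rmorph0, rmorphN, rmorphM, rmorphMn).
Qed.

Lemma map_swap_mx : map_mx f (swap_mx R) = swap_mx S.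
Proof. by rewrite map_seqmx7 /= !(rmorph1, rmorph0, rmorphN). Qed.

Lemma map_theta_mx A B :
  map_mx f (sl3_mx A B) = sl3_mx (map_mx f A) (map_mx f B).
Proof.
rewrite /sl3_mx (@map_block_mx _ _ f 1 (3 + 3) 1 (3 + 3)) !map_mx0 map_mx1.
by rewrite map_block_mx !map_mx0.
Qed.

Lemma map_elem_mx i j t : map_mx f (elem_mx i j t) = elem_mx i j (f t).
Proof. by rewrite /elem_mx map_mxD map_mx1 map_mxZ map_delta_mx. Qed.
End NaturalMx.

Section Closure.
Variables (F M : fieldType) (io : {rmorphism F -> M}) (n : nat).
Hypothesis F_infinite : infinite_field F.
Implicit Types (g : 'M[M]_7) (N : 'M[M]_3).

(** Membership in the Zariski closure of G(F).  The test functions are the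
    polynomials in the n rows of [W *m g], with coefficients and base point [W]
    in M; they are stable under translations, and they are the functions to
    which membership is applied. *)
Definition aut_closure g : Prop :=
  forall (W : 'M[M]_(n, 7)) (h : {mpoly M[n * 7]}),
    (forall k, aut_mx k -> h.@[mxvec (W *m map_mx io k) 0] = 0) ->
    h.@[mxvec (W *m g) 0] = 0.

Lemma aut_closure_aut k : aut_mx k -> aut_closure (map_mx io k).
Proof. by move=> autk W h; apply. Qed.

(** The usual argument that the closure of a group is stable under products,
    fixing one factor at a time. *)
Lemma aut_closureM g g' :
  aut_closure g -> aut_closure g' -> aut_closure (g *m g').
Proof.
move=> cg cg' W h hW; rewrite mulmxA -meval_subst; apply: cg => k autk.
rewrite meval_subst; apply: cg' => l autl.
by rewrite -mulmxA -map_mxM; apply: hW; apply: aut_mxM.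
Qed.

(** A polynomial in one parameter that vanishes on the infinite set F is zero,
    so a polynomial curve stays in the closure as soon as its F-points do. *)
Lemma aut_closure_curve (G : 'M[{poly M}]_7) (t : M) :
  (forall c : F, aut_closure (map_mx (horner_eval (io c)) G)) ->
  aut_closure (map_mx (horner_eval t) G).
Proof.
move=> cG W h hW.
pose P : {poly M} :=
  mmap (polyC \o idfun) (mxvec (map_mx polyC W *m G) 0) h.
have PE s : P.[s] = h.@[mxvec (W *m map_mx (horner_eval s) G) 0].
  rewrite meval_mmap horner_mmap; apply: eq_mmap => // r.
  case/mxvec_indexP: r => i k; rewrite !mxvecE !mxE horner_sum.
  by apply: eq_bigr => l _; rewrite hornerM !mxE hornerC.
have P0 : P = 0.
  by apply: (poly_eq0_infinite (f := io)) => // c; rewrite PE; apply: cG.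
by rewrite -PE P0 horner0.
Qed.

(** Both directions are used: [g] carries the generic tuple to its normal form,
    and its inverse, also in the closure, shows that a polynomial cannot vanish
    on all F-rational translates of the normal form. *)
Definition aut_closure_inv g : Prop :=
  exists g', [/\ aut_closure g, aut_closure g' & g *m g' = 1%:M].

Lemma aut_closure_invM g g' :
  aut_closure_inv g -> aut_closure_inv g' -> aut_closure_inv (g *m g').
Proof.
move=> [h [cg ch gh]] [h' [cg' ch' gh']].
exists (h' *m h); split; try exact: aut_closureM.
by rewrite mulmxA -(mulmxA g) gh' mulmx1.
Qed.

Lemma upper_unip_closure a b c : aut_closure_inv (upper_unip a b c).
Proof.
have cl x y z : aut_closure (upper_unip x y z).
  (* The three parameters are released from F to M one after the other. *)
  have cE s t u v :
      map_mx (horner_eval t) (upper_unip s u v)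
      = upper_unip s.[t] u.[t] v.[t] by rewrite map_upper_unip.
  have := @aut_closure_curve (upper_unip 'X y%:P z%:P) x.
  rewrite cE !hornerE; apply=> x'; rewrite cE !hornerE.
  have := @aut_closure_curve (upper_unip (io x')%:P 'X z%:P) y.
  rewrite cE !hornerE; apply=> y'; rewrite cE !hornerE.
  have := @aut_closure_curve (upper_unip (io x')%:P (io y')%:P 'X) z.
  rewrite cE !hornerE; apply=> z'; rewrite cE !hornerE.
  by rewrite -map_upper_unip; apply/aut_closure_aut/upper_unip_aut.
by exists (upper_unip (- a) (- b) (- c)); split=> //; exact: upper_unipK.
Qed.

Lemma swap_closure : aut_closure_inv (swap_mx M).
Proof.
have cl : aut_closure (swap_mx M).
  by rewrite -(map_swap_mx io); apply/aut_closure_aut/swap_aut.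
by exists (swap_mx M); split=> //; exact: swap_mxK.
Qed.

Lemma sl3_elem_closure i j t : i != j ->
  aut_closure_inv (sl3_mx (elem_mx i j t) (elem_mx j i (- t))).
Proof.
move=> ij; have ji : j != i by rewrite eq_sym.
have cl s : aut_closure (sl3_mx (elem_mx i j s) (elem_mx j i (- s))).
  have cE u r : map_mx (horner_eval r) (sl3_mx (elem_mx i j u) (elem_mx j i (- u)))
      = sl3_mx (elem_mx i j u.[r]) (elem_mx j i (- u.[r])).
    by rewrite map_theta_mx !map_elem_mx rmorphN.
  have := @aut_closure_curve (sl3_mx (elem_mx i j 'X) (elem_mx j i (- 'X))) s.
  rewrite cE !hornerE; apply=> s'; rewrite cE !hornerE.
  rewrite -rmorphN -!map_elem_mx -map_theta_mx.
  by apply/aut_closure_aut/sl3_elem_aut.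
exists (sl3_mx (elem_mx i j (- t)) (elem_mx j i (- - t))); split=> //.
by rewrite sl3_mxM !elem_mxM // !subrr !elem_mx0 sl3_mx1.
Qed.
End Closure.

(** * Generation of SL_3 by transvections *)

Lemma det_mx33 (R : comNzRingType) (N : 'M[R]_3) : \det N =
  N 0 0 * (N 1 1 * N 2%:R 2%:R - N 1 2%:R * N 2%:R 1)
  - N 0 1 * (N 1 0 * N 2%:R 2%:R - N 1 2%:R * N 2%:R 0)
  + N 0 2%:R * (N 1 0 * N 2%:R 1 - N 1 1 * N 2%:R 0).
Proof.
have det2 (A : 'M[R]_2) : \det A = A 0 0 * A 1 1 - A 0 1 * A 1 0.
  rewrite (expand_det_row _ 0) !big_ord_recr big_ord0 /= add0r.
  rewrite /cofactor !det_mx11 !mxE /= expr0 expr1 mul1r mulN1r mulrN.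
  by congr (A _ _ * A _ _ - A _ _ * A _ _); apply: val_inj.
rewrite (expand_det_row _ 0) sum_ord3 /cofactor !det2 !mxE /=.
rewrite expr0 expr1 sqrrN expr1n !mul1r mulN1r mulrN.
by congr (_ * (N _ _ * N _ _ - N _ _ * N _ _)
  - _ * (N _ _ * N _ _ - N _ _ * N _ _)
  + _ * (N _ _ * N _ _ - N _ _ * N _ _)); apply: val_inj.
Qed.

Section SpecialLinear.
Variables (F M : fieldType) (io : {rmorphism F -> M}) (n : nat).
Hypothesis F_infinite : infinite_field F.
Implicit Types (N : 'M[M]_3) (i j : 'I_3).

Let sl_closed N :=
  N \in unitmx -> aut_closure_inv io n (sl3_mx (invmx N) N^T).

Let det_elem i j t : i != j -> \det (elem_mx i j t : 'M[M]_3) = 1.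
Proof.
elim/ord3_ind: i; elim/ord3_ind: j => // _.
all: by rewrite det_mx33 !mxE /=; ring.
Qed.

Let elem_unit i j t : i != j -> (elem_mx i j t : 'M[M]_3) \in unitmx.
Proof. by move=> ij; rewrite unitmxE det_elem ?unitr1. Qed.

Let tr_elem i j t : (elem_mx i j t : 'M[M]_3)^T = elem_mx j i t.
Proof. by rewrite /elem_mx !linearE /= trmx1 trmx_delta. Qed.

Let sl_row i j t N : i != j -> sl_closed (elem_mx i j t *m N) -> sl_closed N.
Proof.
move=> ij cN uN; have ji : j != i by rewrite eq_sym.
have uE := elem_unit t ij.
have := aut_closure_invM (cN _) (sl3_elem_closure io n F_infinite t ij).
rewrite unitmx_mul uE uN => /(_ isT).
rewrite sl3_mxM trmx_mul tr_elem.
have -> : invmx (elem_mx i j t *m N) = invmx N *m invmx (elem_mx i j t).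
  by rewrite -!/(_^-1) invrM.
by rewrite mulmxKV // -mulmxA elem_mxM // subrr elem_mx0 mulmx1.
Qed.

Let sl_col i j t N : i != j -> sl_closed (N *m elem_mx i j t) -> sl_closed N.
Proof.
move=> ij cN uN; have ji : j != i by rewrite eq_sym.
have uE := elem_unit t ij.
have := aut_closure_invM (sl3_elem_closure io n F_infinite t ij) (cN _).
rewrite unitmx_mul uE uN => /(_ isT).
rewrite sl3_mxM trmx_mul tr_elem.
have -> : invmx (N *m elem_mx i j t) = invmx (elem_mx i j t) *m invmx N.
  by rewrite -!/(_^-1) invrM.
by rewrite mulKVmx // mulmxA elem_mxM // addNr elem_mx0 mul1mx.
Qed.

Let elem_mulE i j t N l k :
  (elem_mx i j t *m N) l k = N l k + (l == i)%:R * (t * N j k).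
Proof.
have := congr1 (fun A : 'M_3 => A k l) (trmx_mul (elem_mx i j t) N).
by rewrite mxE tr_elem elem_mxE !mxE => ->.
Qed.

(** Gaussian elimination: every matrix of determinant 1 is a product of
    transvections.  The element is indexed by the inverse of [N] because [N] is
    the matrix of vectors that is to be moved to the standard basis. *)
Lemma sl3_closure N :
  \det N = 1 -> aut_closure_inv io n (sl3_mx (invmx N) N^T).
Proof.
move=> dN; suff: sl_closed N by apply; rewrite unitmxE dN unitr1.
have dr i j (t : M) (A : 'M[M]_3) : i != j -> \det A = 1 -> \det (elem_mx i j t *m A) = 1.
  by move=> ij dA; rewrite det_mulmx dA det_elem // mulr1.
have dc i j (t : M) (A : 'M[M]_3) : i != j -> \det A = 1 -> \det (A *m elem_mx i j t) = 1.
  by move=> ij dA; rewrite det_mulmx dA det_elem // mulr1.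
pose o2 : 'I_3 := 2%:R.
(* From the last step of the elimination to the first.  In S5 the last entry of
   the cleared matrix C is 1 because its determinant is. *)
have S5 (A : 'M[M]_3) : \det A = 1 -> A 0 0 = 1 -> A 1 0 = 0 -> A o2 0 = 0 ->
    A 0 1 = 0 -> A 0 o2 = 0 -> A 1 1 = 1 -> sl_closed A.
  move=> dA a00 a10 a20 a01 a02 a11.
  apply: (@sl_row o2 1 (- A o2 1)) => //; set B := _ *m _.
  apply: (@sl_col 1 o2 (- B 1 o2)) => //; set C := _ *m _.
  have dC : \det C = 1 by apply: dc => //; apply: dr.
  have -> : C = 1%:M.
    have CE : C o2 o2 = 1.
      move: dC; rewrite det_mx33 !elem_mxE !elem_mulE /= -/o2.
      rewrite a00 a10 a20 a01 a02 a11 => dC; rewrite -[RHS]dC; ring.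
    by apply/matrixP; elim/ord3_ind; elim/ord3_ind; rewrite ?CE // [RHS]mxE
      ?elem_mxE ?elem_mulE /= -/o2 ?a00 ?a10 ?a20 ?a01 ?a02 ?a11; ring.
  move=> _; rewrite invmx1 trmx1 sl3_mx1 -swap_mxK.
  exact: aut_closure_invM (swap_closure _ _) (swap_closure _ _).
have S4 (A : 'M[M]_3) : \det A = 1 -> A 0 0 = 1 -> A 1 0 = 0 -> A o2 0 = 0 ->
    A 0 1 = 0 -> A 0 o2 = 0 -> A o2 1 != 0 -> sl_closed A.
  move=> dA a00 a10 a20 a01 a02 a21.
  apply: (@sl_row 1 o2 ((1 - A 1 1) / A o2 1)) => //.
  apply: S5; rewrite ?dr // !elem_mulE /= -/o2 ?a00 ?a10 ?a20 ?a01 ?a02 ?(mulr0, mul0r, addr0) //.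
  by rewrite mul1r divfK // addrC subrK.
have S3 (A : 'M[M]_3) : \det A = 1 -> A 0 0 = 1 -> A 1 0 = 0 -> A o2 0 = 0 ->
    A 0 1 = 0 -> A 0 o2 = 0 -> sl_closed A.
  move=> dA a00 a10 a20 a01 a02.
  have [a21|a21] := eqVneq (A o2 1) 0; last exact: S4.
  apply: (@sl_row o2 1 1) => //.
  apply: S4; rewrite ?dr // !elem_mulE /= -/o2 ?a00 ?a10 ?a20 ?a01 ?a02 ?(mulr0, mul0r, addr0) //.
  rewrite a21 add0r !mul1r; apply/eqP => a11.
  have /eqP := dA; rewrite det_mx33 -/o2 a00 a01 a02 a11 a21.
  by rewrite !(mul0r, mulr0, subr0, addr0) eq_sym oner_eq0.
have S2 (A : 'M[M]_3) : \det A = 1 -> A 0 0 = 1 -> sl_closed A.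
  move=> dA a00.
  apply: (@sl_row 1 0 (- A 1 0)) => //; apply: (@sl_row o2 0 (- A o2 0)) => //.
  apply: (@sl_col 0 1 (- A 0 1)) => //; apply: (@sl_col 0 o2 (- A 0 o2)) => //.
  apply: S3; rewrite ?dc ?dr // !elem_mxE !elem_mulE /= -/o2 a00; ring.
have S1 (A : 'M[M]_3) : \det A = 1 -> A 1 0 != 0 -> sl_closed A.
  move=> dA a10; apply: (@sl_row 0 1 ((1 - A 0 0) / A 1 0)) => //.
  apply: S2; rewrite ?dr // elem_mulE /=.
  by rewrite mul1r divfK // addrC subrK.
have [n10|] := eqVneq (N 1 0) 0; last exact: S1.
have [n00|n00] := eqVneq (N 0 0) 0; last first.
  by apply: (@sl_row 1 0 1) => //; apply: S1; rewrite ?dr // elem_mulE n10 add0r !mul1r.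
apply: (@sl_row 1 o2 1) => //; apply: S1; rewrite ?dr // elem_mulE n10 add0r !mul1r.
apply/eqP => n20; have /eqP := dN; rewrite det_mx33 n10 n20 n00.
by rewrite !(mul0r, mulr0, subr0, addr0) eq_sym oner_eq0.
Qed.
End SpecialLinear.

(** * The invariants and the normal form *)

Section Invariants.
Variables (R : comNzRingType) (m : nat).
Implicit Types (x y z w : nat -> R) (W : 'M[R]_(3 + m, 7)).

Definition top_invs x y z : seq R :=
  [:: form2 x x; form2 x y; form2 x z; form2 y y; form2 y z; form2 z z;
      form3 y z x].

Definition bot_invs x y z w : seq R :=
  [:: form2 x w; form2 y w; form2 z w; form3 x y w; form3 x z w; form3 y z w;
      form4 x y z w].

Definition top W (i : 'I_3) : nat -> R := crd (row (lshift m i) W).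
Definition bot W (j : 'I_m) : nat -> R := crd (row (rshift 3 j) W).

Definition invs W : 'rV[R]_(7 + m * 7) :=
  row_mx (\row_i nth 0 (top_invs (top W 0) (top W 1) (top W 2%:R)) i)
    (mxvec (\matrix_(j, i)
       nth 0 (bot_invs (top W 0) (top W 1) (top W 2%:R) (bot W j)) i)).

Definition top_vals (Y : 'rV[R]_(7 + m * 7)) : nat -> R := crd (lsubmx Y).
Definition bot_vals (Y : 'rV[R]_(7 + m * 7)) (j : 'I_m) : nat -> R :=
  crd (row j (vec_mx (rsubmx Y))).

Lemma top_vals_invs W k : (k < 7)%N ->
  top_vals (invs W) k = nth 0 (top_invs (top W 0) (top W 1) (top W 2%:R)) k.
Proof. by move=> k7; rewrite /top_vals row_mxKl /crd mxE inordK. Qed.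

Lemma bot_vals_invs W j k : (k < 7)%N ->
  bot_vals (invs W) j k
  = nth 0 (bot_invs (top W 0) (top W 1) (top W 2%:R) (bot W j)) k.
Proof. by move=> k7; rewrite /bot_vals row_mxKr mxvecK /crd !mxE inordK. Qed.

Lemma vals_inj Y Y' :
  (forall k, (k < 7)%N -> top_vals Y k = top_vals Y' k) ->
  (forall j k, (k < 7)%N -> bot_vals Y j k = bot_vals Y' j k) -> Y = Y'.
Proof.
move=> tYY' bYY'; rewrite -(hsubmxK Y) -(hsubmxK Y'); congr row_mx.
  exact: crd_inj.
rewrite -(vec_mxK (rsubmx Y)) -(vec_mxK (rsubmx Y')); congr mxvec.
by apply/row_matrixP => j; apply: crd_inj => k; apply: bYY'.
Qed.
End Invariants.

Section NaturalInvs.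
Variables (R S : comNzRingType) (f : {rmorphism R -> S}).
Variables (x y z w : nat -> R) (x' y' z' w' : nat -> S).
Hypotheses (fx : forall k, f (x k) = x' k) (fy : forall k, f (y k) = y' k)
  (fz : forall k, f (z k) = z' k) (fw : forall k, f (w k) = w' k).

Lemma rmorph_form2 : f (form2 x y) = form2 x' y'.
Proof.
by rewrite /form2 /dot3 /upper /lower -!(fx, fy); ring.
Qed.

Lemma rmorph_form3 : f (form3 x y z) = form3 x' y' z'.
Proof.
rewrite /form3 /dot3 /cross3 /upper /lower /=.
rewrite -!(fx, fy, fz); ring.
Qed.

Lemma rmorph_form4 : f (form4 x y z w) = form4 x' y' z' w'.
Proof.
rewrite /form4 /dot3 /cross3 /upper /lower /=.
rewrite -!(fx, fy, fz, fw); ring.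
Qed.
End NaturalInvs.

Lemma map_invs (R S : comNzRingType) (f : {rmorphism R -> S}) (m : nat)
    (W : 'M[R]_(3 + m, 7)) : map_mx f (invs W) = invs (map_mx f W).
Proof.
have tE i k : f (top W i k) = top (map_mx f W) i k by rewrite /top /crd !mxE.
have bE j k : f (bot W j k) = bot (map_mx f W) j k by rewrite /bot /crd !mxE.
rewrite /invs map_row_mx map_mxvec; congr (row_mx _ (mxvec _)).
  apply/rowP => i; rewrite !mxE.
  by case: i => [[|[|[|[|[|[|[|]]]]]]] i] //=;
    first [apply: rmorph_form2 | apply: rmorph_form3] => k; exact: tE.
apply/matrixP => j i; rewrite !mxE.
by case: i => [[|[|[|[|[|[|[|]]]]]]] i] //=;
  first [apply: rmorph_form2 | apply: rmorph_form3 | apply: rmorph_form4] => k;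
  first [exact: tE | exact: bE].
Qed.

(** The formulas below solve the equations that the invariants [t] of the first
    three vectors, and [b] of a further one, impose on a tuple in normal form
    (al; 0; 0), (a2; e_1; (p, q, 0)), (a3; e_2; (r, s, 0)): for instance
    t_1 = 2 al a2, t_3 = 2 (a2^2 + p), t_4 = 2 a2 a3 + r + q and
    t_6 = al (r - q). *)
Section NormalForm.
Variables (E : fieldType) (m : nat).
Hypothesis two_neq0 : 2%:R != 0 :> E.
Implicit Types (al : E) (t b x y z w : nat -> E).

Definition sec2 al t : E := t 1%N / (2%:R * al).
Definition sec3 al t : E := t 2%N / (2%:R * al).
Definition secp al t : E := t 3%N / 2%:R - sec2 al t ^+ 2.
Definition secs al t : E := t 5%N / 2%:R - sec3 al t ^+ 2.
Definition secr al t : E :=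
  (t 4%N - 2%:R * sec2 al t * sec3 al t + t 6%N / al) / 2%:R.
Definition secq al t : E :=
  (t 4%N - 2%:R * sec2 al t * sec3 al t - t 6%N / al) / 2%:R.
Definition secdet al t : E := secp al t * secs al t - secq al t * secr al t.

Definition sect_top al t : seq (seq E) :=
  [:: [:: al; 0; 0; 0; 0; 0; 0];
      [:: sec2 al t; 1; 0; 0; secp al t; secq al t; 0];
      [:: sec3 al t; 0; 1; 0; secr al t; secs al t; 0]].

(** For the vector (a; c; d), the invariants give a, then the sum P1 and the
    difference D1 of d_1 and c.v_2, the same P2, D2 for d_2 and c.v_3, and
    P3, D3 for c_3 and [secdet] times d_3; here v_2 = (p, q, 0) and
    v_3 = (r, s, 0) are the lower vectors of the second and third octonions.
    The entries c_1, c_2 follow by Cramer's rule. *)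
Definition sect_bot al t b : seq E :=
  let a := b 0%N / (2%:R * al) in
  let P1 := b 1%N - 2%:R * sec2 al t * a in
  let D1 := b 3%N / al in
  let P2 := b 2%N - 2%:R * sec3 al t * a in
  let D2 := b 4%N / al in
  let D3 := b 5%N - a * (secr al t - secq al t) + sec3 al t * D1 - sec2 al t * D2 in
  let P3 := a * (2%:R * sec2 al t * sec3 al t + secr al t + secq al t)
            - b 6%N / al + sec2 al t * P2 - sec3 al t * P1 in
  let e := (P1 - D1) / 2%:R in
  let f := (P2 - D2) / 2%:R in
  [:: a; (secs al t * e - secq al t * f) / secdet al t;
      (secp al t * f - secr al t * e) / secdet al t;
      (P3 + D3) / 2%:R; (P1 + D1) / 2%:R; (P2 + D2) / 2%:R;
      (P3 - D3) / (2%:R * secdet al t)].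

Definition sect al (Y : 'rV[E]_(7 + m * 7)) : 'M[E]_(3 + m, 7) :=
  col_mx
    (\matrix_(i, k) nth 0 (nth [::] (sect_top al (top_vals Y)) i) k)
    (\matrix_(j, k) nth 0 (sect_bot al (top_vals Y) (bot_vals Y j)) k).

Lemma top_sect al Y (i : 'I_3) k : (k < 7)%N ->
  top (sect al Y) i k = nth 0 (nth [::] (sect_top al (top_vals Y)) i) k.
Proof. by move=> k7; rewrite /top /crd mxE col_mxEu mxE inordK. Qed.

Lemma bot_sect al Y (j : 'I_m) k : (k < 7)%N ->
  bot (sect al Y) j k = nth 0 (sect_bot al (top_vals Y) (bot_vals Y j)) k.
Proof. by move=> k7; rewrite /bot /crd mxE col_mxEd mxE inordK. Qed.

(** The values of the invariants are arbitrary once the first one is 2 al^2; this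
    is what makes them independent. *)
Lemma invs_sect al Y : al != 0 -> secdet al (top_vals Y) != 0 ->
  top_vals Y 0%N = 2%:R * al ^+ 2 -> invs (sect al Y) = Y.
Proof.
move=> al0 de0 t0; have tE := @top_sect al Y; have bE := @bot_sect al Y.
apply: vals_inj => [k k7|j k k7].
  rewrite top_vals_invs //.
  case: k k7 => [|[|[|[|[|[|[|//]]]]]]] _ /=;
    rewrite /form2 /form3 /dot3 /cross3 /upper /lower /= !tE //= ?t0;
    rewrite /secp /secs /secr /secq /sec2 /sec3; field;
    by rewrite ?al0 ?two_neq0.
rewrite bot_vals_invs //.
case: k k7 => [|[|[|[|[|[|[|//]]]]]]] _ /=.
all: rewrite /form2 /form3 /form4 /dot3 /cross3 /upper /lower /= !tE //= !bE //=.
all: move: de0; rewrite /secdet.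
all: move: (secp _ _) (secq _ _) (secr _ _) (secs _ _) (sec2 _ _) (sec3 _ _) => p q r s a2 a3 de0.
all: field.
all: by rewrite ?al0 ?two_neq0 ?de0.
Qed.

(** A tuple in normal form is a rational function of al and of its invariants;
    this is what makes the invariants generate. *)
Lemma sect_invs al a2 a3 p q r s (W : 'M[E]_(3 + m, 7)) :
  al != 0 -> p * s - q * r != 0 ->
  (forall k, (k < 7)%N -> top W 0 k = nth 0 [:: al; 0; 0; 0; 0; 0; 0] k) ->
  (forall k, (k < 7)%N -> top W 1 k = nth 0 [:: a2; 1; 0; 0; p; q; 0] k) ->
  (forall k, (k < 7)%N -> top W 2%:R k = nth 0 [:: a3; 0; 1; 0; r; s; 0] k) ->
  sect al (invs W) = W.
Proof.
move=> al0 de0 W0 W1 W2.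
pose t := top_vals (invs W).
have tE k : (k < 7)%N -> t k = _ := @top_vals_invs E m W k.
have a2E : sec2 al t = a2.
  rewrite /sec2 tE //= /form2 /dot3 /upper /lower !(W0, W1) //=; field.
  by rewrite al0 two_neq0.
have a3E : sec3 al t = a3.
  rewrite /sec3 tE //= /form2 /dot3 /upper /lower !(W0, W2) //=; field.
  by rewrite al0 two_neq0.
have pE : secp al t = p.
  by rewrite /secp a2E tE //= /form2 /dot3 /upper /lower !W1 //=; field.
have sE : secs al t = s.
  by rewrite /secs a3E tE //= /form2 /dot3 /upper /lower !W2 //=; field.
have t4 : t 4%N = 2%:R * a2 * a3 + r + q.
  by rewrite tE //= /form2 /dot3 /upper /lower !(W1, W2) //=; ring.
have t6 : t 6%N = al * (r - q).
  by rewrite tE //= /form3 /dot3 /cross3 /upper /lower !(W0, W1, W2) //=; ring.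
have rE : secr al t = r.
  by rewrite /secr a2E a3E t4 t6; field; rewrite al0 two_neq0.
have qE : secq al t = q.
  by rewrite /secq a2E a3E t4 t6; field; rewrite al0 two_neq0.
rewrite -[RHS](vsubmxK W) /sect -/t; congr col_mx.
  apply/matrixP => i k; rewrite mxE /sect_top a2E a3E pE qE rE sE mxE.
  have -> : W (lshift m i) k = top W i k by rewrite /top /crd mxE inord_val.
  by elim/ord3_ind: i; rewrite ?W0 ?W1 ?W2.
apply/matrixP => j k; rewrite mxE mxE.
have -> : W (rshift 3 j) k = bot W j k by rewrite /bot /crd mxE inord_val.
have bE l : (l < 7)%N -> bot_vals (invs W) j l = _ := @bot_vals_invs E m W j l.
rewrite /sect_bot /secdet a2E a3E pE qE rE sE !bE //=.
rewrite /form2 /form3 /form4 /dot3 /cross3 /upper /lower /= !(W0, W1, W2) //=.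
by case: k => [[|[|[|[|[|[|[|//]]]]]]] k] /=; field; rewrite ?al0 ?two_neq0 ?de0.
Qed.
End NormalForm.

(** * Invariance, and reduction to the normal form *)

Lemma map_generic_point (F M : fieldType) (io : {rmorphism F -> M}) (n : nat)
    (W : 'M[M]_(n, 7)) :
  map_mx (mmap io (mxvec W 0)) (generic_point0 F n) = W.
Proof.
by apply/matrixP => i k; rewrite mxE generic_point0E mmapX mmap1U mxvecE.
Qed.

Definition generic_invs (F : fieldType) (m : nat) :=
  invs (generic_point0 F (3 + m)).

Lemma mmap_generic_invs (F M : fieldType) (io : {rmorphism F -> M}) (m : nat)
    (W : 'M[M]_(3 + m, 7)) r :
  mmap io (mxvec W 0) (generic_invs F m 0 r) = invs W 0 r.
Proof. by rewrite -[in RHS](map_generic_point io W) -map_invs [RHS]mxE. Qed.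

Lemma invs_octAut (F : fieldType) (m : nat) (g : octAut F)
    (W : 'M[F]_(3 + m, 7)) : invs (W *m octAut_mx g) = invs W.
Proof.
apply: vals_inj => [k k7|j k k7].
  rewrite !top_vals_invs // /top !row_mul.
  by case: k k7 => [|[|[|[|[|[|[|]]]]]]] //= _;
    rewrite (form2_octAut, form3_octAut).
rewrite !bot_vals_invs // /top /bot !row_mul.
by case: k k7 => [|[|[|[|[|[|[|]]]]]]] //= _;
  rewrite (form2_octAut, form3_octAut, form4_octAut).
Qed.

(** The Gram determinant of the first three vectors plus 2 t(z_1 (z_2 z_3))^2.
    Up to the factor 4 t(z_1 z_1) it is the determinant p s - q r of the normal
    form ([secdet_discr]), and it does not involve al. *)
Definition discr (R : comNzRingType) (t : nat -> R) : R :=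
  t 0%N * (t 3%N * t 5%N - t 4%N ^+ 2) - t 1%N * (t 1%N * t 5%N - t 4%N * t 2%N)
  + t 2%N * (t 1%N * t 4%N - t 3%N * t 2%N) + 2%:R * t 6%N ^+ 2.

Lemma rmorph_discr (R S : comNzRingType) (f : {rmorphism R -> S})
    (t : nat -> R) (t' : nat -> S) :
  (forall k, f (t k) = t' k) -> f (discr t) = discr t'.
Proof. by move=> ft; rewrite /discr -!ft; ring. Qed.

Section Reduction.
Variables (F M : fieldType) (io : {rmorphism F -> M}) (m : nat).
Hypothesis F_infinite : infinite_field F.
Hypothesis two_neq0 : 2%:R != 0 :> M.
Implicit Types (W : 'M[M]_(3 + m, 7)) (t : nat -> M).

(** The forms are invariant at F-points by [invs_octAut]; F being infinite, this
    is an identity between polynomials, and it can be evaluated over M. *)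
Lemma subst_generic_invs (g : octAut F) r :
  subst_polyO0 (octAut_mx g) (generic_invs F m 0 r) = generic_invs F m 0 r.
Proof.
apply/eqP; rewrite -subr_eq0; apply/eqP; apply: mpoly_eq0_infinite => // v.
have vE : v =1 mxvec (vec_mx (\row_i v i) : 'M[F]_(3 + m, 7)) 0.
  by move=> i; rewrite vec_mxK mxE.
rewrite (meval_eq _ vE) meval_mmap rmorphB /= mmap_subst !mmap_generic_invs.
by rewrite map_mx_id // invs_octAut subrr.
Qed.

Lemma invs_closure g W : aut_closure io (3 + m) g -> invs (W *m g) = invs W.
Proof.
move=> cg; apply/rowP => r; apply/eqP; rewrite -subr_eq0; apply/eqP.
pose h : {mpoly M[(3 + m) * 7]} := generic_invs M m 0 r - (invs W 0 r)%:MP.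
have hE W' : h.@[mxvec W' 0] = invs W' 0 r - invs W 0 r.
  by rewrite mevalB mevalC meval_mmap mmap_generic_invs.
rewrite -hE; apply: cg => k [a ->]; rewrite hE; apply/eqP; rewrite subr_eq0.
rewrite -!(mmap_generic_invs io) -mmap_subst subst_generic_invs //.
Qed.

Lemma secdet_discr al t : al != 0 -> t 0%N = 2%:R * al ^+ 2 ->
  4%:R * t 0%N * secdet al t = discr t.
Proof.
move=> al0 t0; rewrite /discr /secdet /secp /secs /secq /secr /sec2 /sec3 t0.
by field; rewrite al0 two_neq0.
Qed.

(** Diagonalizing the first octonion x = (alpha; u; v).  A lower unipotent along
    c v kills v when c is a root of 1 + 2 alpha c - (u.v) c^2, whose discriminant
    is 4 al^2; the diagonal entry becomes al.  An upper unipotent along a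
    multiple of u then kills u. *)
Lemma reduce_first al W :
  let x := top W 0 in
  al != 0 -> dot3 (upper x) (lower x) != 0 ->
  al ^+ 2 = x 0%N ^+ 2 + dot3 (upper x) (lower x) ->
  exists2 g, aut_closure_inv io (3 + m) g &
    forall k, (k < 7)%N -> top (W *m g) 0 k = nth 0 [:: al; 0; 0; 0; 0; 0; 0] k.
Proof.
move=> x al0 b0 alE; set b := dot3 _ _ in b0 alE.
pose c := (x 0%N - al) / b; pose d := - (2%:R * al)^-1.
pose g1 := swap_mx M *m (upper_unip (c * x 4%N) (c * x 5%N) (c * x 6%N) *m swap_mx M).
pose g2 := upper_unip (d * x 1%N) (d * x 2%N) (d * x 3%N).
exists (g1 *m g2).
  have cu := upper_unip_closure io (3 + m) F_infinite.
  have cs := swap_closure io (3 + m).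
  exact: aut_closure_invM (aut_closure_invM cs (aut_closure_invM (cu _ _ _) cs))
    (cu _ _ _).
have E1 k : (k < 7)%N ->
    top (W *m g1) 0 k = nth 0 [:: al; x 1%N; x 2%N; x 3%N; 0; 0; 0] k.
  have bE : x 1%N * x 4%N + x 2%N * x 5%N + x 3%N * x 6%N = b by [].
  have cE : c * b = x 0%N - al by rewrite divfK.
  have sE : c * x 4%N * - x 1%N + c * x 5%N * - x 2%N + c * x 6%N * - x 3%N = al - x 0%N.
    by rewrite -[RHS]opprB -cE -bE; ring.
  have c2 : 1 + c * (al + x 0%N) = 0.
    apply: (mulIf b0); rewrite mul0r mulrDl mul1r mulrAC cE.
    by rewrite (_ : b = al ^+ 2 - x 0%N ^+ 2); [ring | rewrite alE; ring].
  have u0 l : - x l + (- x 0%N *+ 2 - (al - x 0%N)) * (c * x l) = 0.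
    rewrite (_ : _ + _ = - x l * (1 + c * (al + x 0%N))); last by ring.
    by rewrite c2 mulr0.
  have e l : (l < 7)%N ->
      crd (row (lshift m 0) W *m swap_mx M
           *m upper_unip (c * x 4%N) (c * x 5%N) (c * x 6%N)) l
      = nth 0 [:: - al; 0; 0; 0; - x 1%N; - x 2%N; - x 3%N] l.
    move=> l7; rewrite crd_upper_unip //= /dot3 /cross3 /upper /lower /=.
    rewrite !crd_swap //= -/(top W 0) -/x sE !u0.
    by case: l l7 => [|[|[|[|[|[|[|]]]]]]] //= _; ring.
  move=> k7; rewrite /top !row_mul !mulmxA crd_swap //=.
  by case: k k7 => [|[|[|[|[|[|[|]]]]]]] //= _; rewrite e //= ?opprK ?oppr0.
move=> k k7; rewrite mulmxA /top row_mul -/(top _ _) crd_upper_unip //=.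
rewrite /dot3 /cross3 /upper /lower /= -/(top (W *m g1) 0) !E1 //=.
have d2 l : x l + (al *+ 2) * (d * x l) = 0.
  by rewrite /d; field; rewrite al0 two_neq0.
case: k k7 => [|[|[|[|[|[|[|]]]]]]] //= _; rewrite ?mulr0 ?addr0 ?subr0 ?d2 //.
all: by ring.
Qed.

Lemma crd_sl3 (x : 'rV[M]_7) (A B : 'M[M]_3) :
  let y := crd (x *m sl3_mx A B) in
  [/\ y 0%N = crd x 0%N,
      forall i : 'I_3, y i.+1 = (our (oct0 x) *m A) 0 i &
      forall i : 'I_3, y i.+4 = (odl (oct0 x) *m B) 0 i].
Proof.
split=> [|i|i]; first by rewrite -!oul_oct0 oct0_sl3.
  by rewrite -our_oct0 oct0_sl3.
by rewrite -odl_oct0 oct0_sl3.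
Qed.

(** The stabilizer SL_3 of the diagonal octonion puts the second and third
    octonions in normal form. *)
Lemma reduce_second al W :
  al != 0 -> discr (top_vals (invs W)) != 0 ->
  (forall k, (k < 7)%N -> top W 0 k = nth 0 [:: al; 0; 0; 0; 0; 0; 0] k) ->
  exists2 g, aut_closure_inv io (3 + m) g & W *m g = sect al (invs W).
Proof.
move=> al0 di0 W0; pose y := top W 1; pose z := top W 2%:R.
pose p := dot3 (lower y) (upper y); pose q := dot3 (lower y) (upper z).
pose r := dot3 (lower z) (upper y); pose s := dot3 (lower z) (upper z).
have de0 : p * s - q * r != 0.
  apply: contraNneq di0 => de0.
  rewrite (_ : discr _ = 8%:R * al ^+ 2 * (p * s - q * r)); first by rewrite de0 mulr0.
  rewrite /discr !top_vals_invs //= /form2 /form3 /dot3 /cross3 /upper /lower /=.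
  rewrite !W0 //= /p /q /r /s /dot3 /upper /lower -/y -/z; ring.
(* The rows of N go to the standard basis.  The third one, the cross product of
   the two lower vectors divided by p s - q r, makes the determinant 1; being
   orthogonal to these lower vectors, it makes their last entries vanish. *)
pose N : 'M[M]_3 := \matrix_(i, k) nth 0 [:: upper y k; upper z k;
  cross3 (lower y) (lower z) k / (p * s - q * r)] i.
have dN : \det N = 1.
  rewrite det_mx33 !mxE /=; apply: (mulIf de0); rewrite mul1r.
  rewrite /cross3 /=; move: de0; rewrite /p /q /r /s /dot3 /upper /lower => de0.
  by field.
have uN : N \in unitmx by rewrite unitmxE dN unitr1.
exists (sl3_mx (invmx N) N^T); first exact: sl3_closure.
set g := sl3_mx _ _; rewrite -(@invs_closure g W); last first.
  by have [h []] := sl3_closure io (3 + m) F_infinite dN.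
have rowE (x : 'rV[M]_7) (l : 'I_3) : (forall i : 'I_3, crd x i.+1 = N l i) ->
    forall k, (k < 7)%N -> crd (x *m g) k = nth 0
      [:: crd x 0%N; (l == 0)%:R; (l == 1)%:R; (l == 2%:R)%:R;
          dot3 (lower (crd x)) (upper y); dot3 (lower (crd x)) (upper z);
          dot3 (lower (crd x)) (cross3 (lower y) (lower z)) / (p * s - q * r)] k.
  move=> xN; have [e0 eu el] := crd_sl3 x (invmx N) N^T.
  have u0 i : (our (oct0 x) *m invmx N) 0 i = (l == i)%:R.
    have -> : our (oct0 x) = row l N.
      by apply/rowP => i'; rewrite our_oct0 xN [RHS]mxE.
    by rewrite -row_mul mulmxV // !mxE.
  case=> [_|[_|[_|[_|[_|[_|[_|//]]]]]]] /=.
  - exact: e0.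
  - by rewrite (eu 0) u0.
  - by rewrite (eu 1) u0.
  - by rewrite (eu 2%:R) u0.
  - by rewrite (el 0) mxE sum_ord3 !odl_oct0 !mxE.
  - by rewrite (el 1) mxE sum_ord3 !odl_oct0 !mxE.
  - by rewrite (el 2%:R) mxE sum_ord3 !odl_oct0 !mxE /= /dot3 /lower; ring.
have yz0 (f : nat -> M) : f = y \/ f = z ->
    dot3 (lower f) (cross3 (lower y) (lower z)) = 0.
  by case=> ->; rewrite /dot3 /cross3 /=; ring.
apply/esym/(sect_invs two_neq0 al0 de0 (a2 := y 0%N) (a3 := z 0%N)).
- move=> k k7; rewrite /top row_mul.
  have [e0 eu el] := crd_sl3 (row (lshift m 0) W) (invmx N) N^T.
  have o0 : our (oct0 (row (lshift m 0) W)) = 0.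
    by apply/rowP; elim/ord3_ind; rewrite our_oct0 -/(top W 0) W0 // mxE.
  have l0 : odl (oct0 (row (lshift m 0) W)) = 0.
    by apply/rowP; elim/ord3_ind; rewrite odl_oct0 -/(top W 0) W0 // mxE.
  case: k k7 => [_|[_|[_|[_|[_|[_|[_|//]]]]]]] /=.
  + by rewrite e0 -/(top W 0) W0.
  + by rewrite (eu 0) o0 mul0mx mxE.
  + by rewrite (eu 1) o0 mul0mx mxE.
  + by rewrite (eu 2%:R) o0 mul0mx mxE.
  + by rewrite (el 0) l0 mul0mx mxE.
  + by rewrite (el 1) l0 mul0mx mxE.
  + by rewrite (el 2%:R) l0 mul0mx mxE.
- move=> k k7; rewrite /top row_mul (rowE _ 0) //; last by move=> i; rewrite mxE.
  by rewrite -/(top W 1) -/y yz0 ?mul0r; [|left].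
- move=> k k7; rewrite /top row_mul (rowE _ 1) //; last by move=> i; rewrite mxE.
  by rewrite -/(top W 2%:R) -/z yz0 ?mul0r; [|right].
Qed.

Lemma reduce_to_sect al W :
  let x := top W 0 in
  al != 0 -> dot3 (upper x) (lower x) != 0 ->
  al ^+ 2 = x 0%N ^+ 2 + dot3 (upper x) (lower x) ->
  discr (top_vals (invs W)) != 0 ->
  exists2 g, aut_closure_inv io (3 + m) g & W *m g = sect al (invs W).
Proof.
move=> x al0 b0 alE di0.
have [g cg W0] := reduce_first al0 b0 alE.
have gW : invs (W *m g) = invs W by apply: invs_closure; case: cg => h [].
rewrite -gW in di0.
have [g' cg' E] := reduce_second al0 di0 W0.
exists (g *m g'); last by rewrite mulmxA E gW.
exact: aut_closure_invM cg cg'.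
Qed.
End Reduction.

(** * Descent along a square root *)

Definition subfield_pred (L : fieldType) (K : L -> Prop) : Prop :=
  [/\ K 1, forall x y, K x -> K y -> K (x - y),
      forall x y, K x -> K y -> K (x * y) & forall x, K x -> K x^-1].

Section Subfields.
Variables (L : fieldType) (K : L -> Prop).
Hypothesis KP : subfield_pred K.

Lemma subfield1 : K 1. Proof. by case: KP. Qed.
Lemma subfieldB x y : K x -> K y -> K (x - y). Proof. by case: KP => _ H _ _; apply: H. Qed.
Lemma subfieldM x y : K x -> K y -> K (x * y). Proof. by case: KP => _ _ H _; apply: H. Qed.
Lemma subfieldV x : K x -> K x^-1. Proof. by case: KP => _ _ _; apply. Qed.
Lemma subfield0 : K 0.
Proof. by rewrite -(subrr 1); apply: subfieldB; exact: subfield1. Qed.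
Lemma subfieldN x : K x -> K (- x).
Proof. by move=> Kx; rewrite -sub0r; apply: subfieldB => //; exact: subfield0. Qed.
Lemma subfieldD x y : K x -> K y -> K (x + y).
Proof. by move=> Kx Ky; rewrite -[y]opprK; apply/subfieldB/subfieldN. Qed.
Lemma subfield_nat k : K k%:R.
Proof.
elim: k => [|k IH]; first exact: subfield0.
by rewrite mulrS; apply: subfieldD => //; exact: subfield1.
Qed.

Variables (M : fieldType) (j : {rmorphism L -> M}) (al : M) (a : L).
Hypotheses (Ka : K a) (alE : al ^+ 2 = j a).

(** Up to the choice of al, [x] and [x'] are conjugate over K.  A relation is
    used instead of an automorphism so that al may also belong to K. *)
Definition conj_pair (x x' : M) : Prop :=
  exists A B, [/\ K A, K B, x = j A + j B * al & x' = j A - j B * al].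

Lemma conj_pairK c : K c -> conj_pair (j c) (j c).
Proof.
move=> Kc; exists c, 0; split=> //; first exact: subfield0.
  by rewrite rmorph0 mul0r addr0.
by rewrite rmorph0 mul0r subr0.
Qed.

Lemma conj_pair_nat k : conj_pair k%:R k%:R.
Proof. by rewrite -(rmorph_nat j); apply/conj_pairK/subfield_nat. Qed.

Lemma conj_pair_al : conj_pair al (- al).
Proof.
exists 0, 1; split; [exact: subfield0 | exact: subfield1 | |].
  by rewrite rmorph0 rmorph1 mul1r add0r.
by rewrite rmorph0 rmorph1 mul1r sub0r.
Qed.

Lemma conj_pairN x x' : conj_pair x x' -> conj_pair (- x) (- x').
Proof.
move=> [A [B [KA KB -> ->]]]; exists (- A), (- B); split.
- exact: subfieldN.
- exact: subfieldN.
- by rewrite !rmorphN mulNr opprD.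
- by rewrite !rmorphN mulNr opprB opprK addrC.
Qed.

Lemma conj_pairD x x' y y' :
  conj_pair x x' -> conj_pair y y' -> conj_pair (x + y) (x' + y').
Proof.
move=> [A [B [KA KB -> ->]]] [C [D [KC KD -> ->]]].
exists (A + C), (B + D); split; try exact: subfieldD.
- by rewrite !rmorphD; ring.
- by rewrite !rmorphD; ring.
Qed.

Lemma conj_pairB x x' y y' :
  conj_pair x x' -> conj_pair y y' -> conj_pair (x - y) (x' - y').
Proof. by move=> cx cy; apply: conj_pairD => //; apply: conj_pairN. Qed.

Lemma conj_pairM x x' y y' :
  conj_pair x x' -> conj_pair y y' -> conj_pair (x * y) (x' * y').
Proof.
move=> [A [B [KA KB -> ->]]] [C [D [KC KD -> ->]]].
exists (A * C + B * D * a), (A * D + B * C).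
have alE' : j a = al * al by rewrite -alE.
split.
- by apply: subfieldD; do ?apply: subfieldM.
- by apply: subfieldD; apply: subfieldM.
- by rewrite !rmorphD !rmorphM alE'; ring.
- by rewrite !rmorphD !rmorphM alE'; ring.
Qed.

Lemma conj_pairX x x' k : conj_pair x x' -> conj_pair (x ^+ k) (x' ^+ k).
Proof.
move=> cx; elim: k => [|k IH]; first exact: (conj_pair_nat 1).
by rewrite !exprS; apply: conj_pairM.
Qed.

Lemma conj_pairV x x' :
  x != 0 -> x' != 0 -> conj_pair x x' -> conj_pair x^-1 x'^-1.
Proof.
move=> x0 x'0 cx.
have [N KN NE] : exists2 N, K N & x * x' = j N.
  case: cx => A [B [KA KB -> ->]]; exists (A * A - a * (B * B)).
    by apply: subfieldB; do ?apply: subfieldM.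
  by rewrite rmorphB !rmorphM -alE; ring.
have cx' : conj_pair x' x.
  case: cx => A [B [KA KB -> ->]]; exists A, (- B).
  by split; rewrite ?rmorphN ?mulNr ?opprK //; apply: subfieldN.
have -> : x^-1 = x' * j N^-1.
  by rewrite fmorphV -NE invfM mulrCA mulfV // mulr1.
have -> : x'^-1 = x * j N^-1.
  by rewrite fmorphV -NE invfM mulrA mulfV // mul1r.
by apply: conj_pairM => //; apply/conj_pairK/subfieldV.
Qed.

Lemma conj_pair_div x x' y y' : y != 0 -> y' != 0 ->
  conj_pair x x' -> conj_pair y y' -> conj_pair (x / y) (x' / y').
Proof. by move=> y0 y'0 cx cy; apply: conj_pairM => //; apply: conj_pairV. Qed.

Lemma conj_pair_mmap (F : fieldType) (io : {rmorphism F -> M}) (d : nat)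
    (v v' : 'I_d -> M) (p : {mpoly F[d]}) :
  (forall c, conj_pair (io c) (io c)) -> (forall i, conj_pair (v i) (v' i)) ->
  conj_pair (mmap io v p) (mmap io v' p).
Proof.
move=> cio cv; rewrite /mmap.
elim/big_ind2: _ => [|x x' y y'|e _]; [exact: (conj_pair_nat 0)|exact: conj_pairD|].
apply: conj_pairM => //; rewrite /mmap1.
elim/big_ind2: _ => [|x x' y y'|i _]; [exact: (conj_pair_nat 1)|exact: conj_pairM|].
exact: conj_pairX.
Qed.

(** With P = A + B al and Q = C + D al, adding and subtracting the two
    equations gives f C = A and f D = B, and C or D is not zero. *)
Lemma conj_pair_quotient f P P' Q Q' : 2%:R != 0 :> M -> al != 0 ->
  conj_pair P P' -> conj_pair Q Q' -> Q != 0 ->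
  j f * Q = P -> j f * Q' = P' -> K f.
Proof.
move=> two al0 [A [B [KA KB -> ->]]] [C [D [KC KD -> ->]]] Q0 fQ fQ'.
have fC : f * C = A.
  apply: (fmorph_inj j); rewrite rmorphM; apply: (mulfI two).
  have := congr2 +%R fQ fQ'; rewrite -mulrDr => E.
  by rewrite mulrCA (_ : 2%:R * j C = j C + j D * al + (j C - j D * al)) ?E; ring.
have fD : f * D = B.
  apply: (fmorph_inj j); rewrite rmorphM; apply: (mulIf al0); apply: (mulfI two).
  have := congr2 (fun x y => x - y) fQ fQ'; rewrite /= -mulrBr => E.
  transitivity (j f * (j C + j D * al - (j C - j D * al))); first by ring.
  by rewrite E; ring.
have [C0|C0] := eqVneq C 0.
  have D0 : D != 0.
    by apply: contraNneq Q0 => D0; rewrite C0 D0 rmorph0 mul0r addr0.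
  by rewrite -[f](mulfK D0) fD; apply: subfieldM => //; apply: subfieldV.
by rewrite -[f](mulfK C0) fC; apply: subfieldM => //; apply: subfieldV.
Qed.

Section ConjSection.
Hypotheses (two_neq0 : 2%:R != 0 :> M) (al0 : al != 0).
Variable m : nat.
Variable Y : 'rV[L]_(7 + m * 7).
Hypothesis KY : forall r, K (Y 0 r).
Let t : nat -> M := top_vals (map_mx j Y).
Hypotheses (de0 : secdet al t != 0) (de0' : secdet (- al) t != 0).

Let ct k : conj_pair (t k) (t k).
Proof. by rewrite /t /top_vals /crd !mxE; apply: conj_pairK. Qed.

Let cb i k : conj_pair (bot_vals (map_mx j Y) i k) (bot_vals (map_mx j Y) i k).
Proof. by rewrite /bot_vals /crd !mxE; apply: conj_pairK. Qed.

Let al0' : - al != 0. Proof. by rewrite oppr_eq0. Qed.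
Let al2 : 2%:R * al != 0. Proof. by rewrite mulf_neq0. Qed.
Let al2' : 2%:R * - al != 0. Proof. by rewrite mulf_neq0. Qed.

Ltac cpair := repeat first
  [ exact: ct | exact: cb | exact: conj_pair_al | exact: conj_pair_nat
  | assumption
  | apply: conj_pairX | apply: conj_pairN | apply: conj_pair_div
  | apply: conj_pairM | apply: conj_pairD | apply: conj_pairB ].

(** Changing the sign of al exchanges [secq] and [secr] and fixes [secdet];
    every entry of the normal form is built from such conjugate pairs. *)
Lemma conj_pair_sect i k :
  conj_pair (sect al (map_mx j Y) i k) (sect (- al) (map_mx j Y) i k).
Proof.
have c2 : conj_pair (sec2 al t) (sec2 (- al) t) by rewrite /sec2; cpair.
have c3 : conj_pair (sec3 al t) (sec3 (- al) t) by rewrite /sec3; cpair.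
have cp : conj_pair (secp al t) (secp (- al) t) by rewrite /secp; cpair.
have cs : conj_pair (secs al t) (secs (- al) t) by rewrite /secs; cpair.
have cr : conj_pair (secr al t) (secr (- al) t) by rewrite /secr; cpair.
have cq : conj_pair (secq al t) (secq (- al) t) by rewrite /secq; cpair.
have cd : conj_pair (secdet al t) (secdet (- al) t) by rewrite /secdet; cpair.
have d2 : 2%:R * secdet al t != 0 by rewrite mulf_neq0.
have d2' : 2%:R * secdet (- al) t != 0 by rewrite mulf_neq0.
rewrite /sect -/t !mxE; case: splitP => l _; rewrite !mxE.
  have c0 := conj_pair_nat 0; have c1 := conj_pair_nat 1; have ca := conj_pair_al.
  elim/ord3_ind: l; rewrite /sect_top /=;
    by case: k => [[|[|[|[|[|[|[|]]]]]]] k] //=.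
rewrite /sect_bot; case: k => [[|[|[|[|[|[|[|]]]]]]] k] //=; cpair.
Qed.
End ConjSection.
End Subfields.

(** * The field of rational invariants *)

Section GeneratedField.
Variables (F L : fieldType) (iota : {rmorphism F -> L}) (d : nat).
Variable x : 'I_d -> L.

Lemma in_generated_const c : in_generated_field iota x (iota c).
Proof.
exists c%:MP, 1; split; first by rewrite rmorph1 oner_eq0.
by rewrite rmorph1 divr1 mmapC.
Qed.

Lemma in_generated_gen i : in_generated_field iota x (x i).
Proof.
exists 'X_i, 1; split; first by rewrite rmorph1 oner_eq0.
by rewrite rmorph1 divr1 mmapX mmap1U.
Qed.

Lemma in_generated_subfield : subfield_pred (in_generated_field iota x).
Proof.
split.
- by rewrite -(rmorph1 iota); exact: in_generated_const.
- move=> _ _ [p [q [q0 ->]]] [p' [q' [q'0 ->]]].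
  exists (p * q' - p' * q), (q * q'); split; first by rewrite rmorphM mulf_neq0.
  by rewrite rmorphB !rmorphM /=; field; rewrite q0 q'0.
- move=> _ _ [p [q [q0 ->]]] [p' [q' [q'0 ->]]].
  exists (p * p'), (q * q'); split; first by rewrite rmorphM mulf_neq0.
  by rewrite !rmorphM /=; field; rewrite q0 q'0.
- move=> _ [p [q [q0 ->]]]; have [p0|p0] := eqVneq (mmap iota x p) 0.
    rewrite p0 mul0r invr0 -(rmorph0 iota); exact: in_generated_const.
  by exists q, p; split=> //; rewrite invf_div.
Qed.
End GeneratedField.

Lemma map_mpoly_meval (F M : fieldType) (io : {rmorphism F -> M}) (d : nat)
    (v : 'I_d -> M) (p : {mpoly F[d]}) :
  (map_mpoly io p).@[v] = mmap io v p.
Proof.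
rewrite /map_mpoly (@rmorph_mmap _ _ _ _ _ (meval v)).
by apply: eq_mmap => [c|i] /=; rewrite ?mevalC ?mevalXU.
Qed.

Section Main.
Variables (F : fieldType) (m : nat).
Hypothesis F_infinite : infinite_field F.
Hypothesis two_neq0 : 2%:R != 0 :> F.
Local Notation P := {mpoly F[(3 + m) * 7]}.
Local Notation L := {fraction P}.

Definition gen_inv (r : 'I_(7 + m * 7)) : L := (generic_invs F m 0 r)%:F.

Let tofrac : {rmorphism P -> L} := @FracField.tofrac P.

Lemma mmap_gen_inv p :
  mmap (const_ratO0 F (3 + m)) gen_inv p
  = (mmap (@mpolyC _ F) (generic_invs F m 0) p)%:F.
Proof. by rewrite -[RHS]/(tofrac _) rmorph_mmap; apply: eq_mmap. Qed.

(** The invariants of three pairwise orthogonal octonions followed by zeros, a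
    value at which [discr] is easily seen not to vanish. *)
Let Y0 : 'rV[F]_(7 + m * 7) :=
  row_mx (\row_i nth 0 [:: 2%:R; 0; 0; 2%:R; 0; 2%:R; 0] i) 0.

Let Y0E k : (k < 7)%N ->
  top_vals Y0 k = nth 0 [:: 2%:R; 0; 0; 2%:R; 0; 2%:R; 0] k.
Proof. by move=> k7; rewrite /top_vals row_mxKl /crd mxE inordK. Qed.

Let discr_Y0 : discr (top_vals Y0) = 2%:R ^+ 3.
Proof. by rewrite /discr !Y0E //=; ring. Qed.

(** A relation p between the invariants vanishes at every value Y with first
    entry 2 t^2, t and the determinant of the normal form being non-zero.
    Multiplying p by [discr] and by the first variable removes the exceptions,
    and a polynomial in the first variable vanishing at all 2 t^2 is zero. *)
Lemma gen_inv_indep :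
  algebraically_independent (const_ratO0 F (3 + m)) gen_inv.
Proof.
move=> p; rewrite mmap_gen_inv => /eqP; rewrite tofrac_eq0 => /eqP p0.
have pW (W : 'M[F]_(3 + m, 7)) : p.@[invs W 0] = 0.
  have := congr1 (mmap idfun (mxvec W 0)) p0.
  rewrite rmorph0 rmorph_mmap => <-; rewrite meval_mmap.
  by apply: eq_mmap => [c|r] /=; rewrite ?mmapC // mmap_generic_invs.
pose r0 : 'I_(7 + m * 7) := lshift (m * 7) 0.
pose Xr : 'rV[{mpoly F[7 + m * 7]}]_(7 + m * 7) := \row_r 'X_r.
pose D := discr (top_vals Xr).
have DE v : D.@[v] = discr (top_vals (\row_r v r)).
  apply: rmorph_discr => k; rewrite /top_vals /crd !mxE; exact: mevalXU.
have topr0 (v : 'I_(7 + m * 7) -> F) : top_vals (\row_r v r) 0%N = v r0.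
  rewrite /top_vals /crd !mxE; congr (v (lshift _ _)).
  by apply: val_inj; rewrite /= inordK.
have sq v t : v r0 = 2%:R * t ^+ 2 -> (p * D * 'X_r0).@[v] = 0.
  move=> vt; rewrite !mevalM DE mevalXU.
  have [t0|t0] := eqVneq t 0; first by rewrite vt t0 expr0n mulr0 mulr0.
  have [->|d0] := eqVneq (discr (top_vals (\row_r v r))) 0.
    by rewrite mulr0 mul0r.
  have e0 : secdet t (top_vals (\row_r v r)) != 0.
    apply: contraNneq d0 => e0.
    by rewrite -(secdet_discr two_neq0 t0) ?e0 ?mulr0 // topr0.
  have := pW (sect t (\row_r v r)).
  rewrite invs_sect ?topr0 // => pv; rewrite (_ : p.@[v] = 0) ?mul0r //.
  by rewrite -[RHS]pv; apply: meval_eq => r; rewrite mxE.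
have : p * D * 'X_r0 = 0.
  apply: mpoly_eq0_infinite => // v.
  pose h r : {poly F} := if r == r0 then 'X else (v r)%:P.
  pose H := mmap (polyC \o idfun) h (p * D * 'X_r0).
  have HE t : H.[t] = (p * D * 'X_r0).@[fun r => if r == r0 then t else v r].
    rewrite horner_mmap meval_mmap; apply: eq_mmap => // r.
    by rewrite /h; case: eqP => _; rewrite (hornerX, hornerC).
  have H0 : H = 0.
    apply: (poly_eq0_squares F_infinite two_neq0) => t.
    by rewrite HE; apply: (sq _ t); rewrite eqxx.
  have := HE (v r0); rewrite H0 horner0 => ->.
  by apply: meval_eq => r; case: eqP => // ->.
move/eqP; rewrite !mulf_eq0 -orbA => /or3P [/eqP //|/eqP D0|/eqP X0].
  have := DE (Y0 0); rewrite D0 meval0.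
  have -> : \row_r Y0 0 r = Y0 by apply/rowP => r; rewrite mxE.
  by rewrite discr_Y0 => /esym/eqP; rewrite expf_eq0 (negPf two_neq0).
have := congr1 (meval (fun=> 1)) X0; rewrite mevalXU meval0 => /eqP.
by rewrite oner_eq0.
Qed.

Lemma gen_invariant f :
  in_generated_field (const_ratO0 F (3 + m)) gen_inv f ->
  @invariant_ratO0 F (3 + m) f.
Proof.
move=> [p [q [q0 ->]]] g; rewrite !mmap_gen_inv.
have q0' : mmap (@mpolyC _ F) (generic_invs F m 0) q != 0.
  by move: q0; rewrite mmap_gen_inv tofrac_eq0.
rewrite act_ratO0E // /act_polyO0.
have E s : subst_polyO0 (octAut_mx (octAutV g))
    (mmap (@mpolyC _ F) (generic_invs F m 0) s)
    = mmap (@mpolyC _ F) (generic_invs F m 0) s.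
  rewrite {1}/subst_polyO0 (@rmorph_mmap _ _ _ _ _ (comp_mpoly _)).
  apply: eq_mmap => [c|r] /=; first exact: comp_mpolyC.
  exact: subst_generic_invs.
by rewrite !E.
Qed.

Lemma invariant_cross (p q : P) : q != 0 ->
  @invariant_ratO0 F (3 + m) (p%:F / q%:F) -> forall k, aut_mx k ->
  subst_polyO0 k p * q = p * subst_polyO0 k q.
Proof.
move=> q0 fG _ [g ->].
have aq0 : act_polyO0 (octAutV g) q != 0.
  have a0 : act_polyO0 (octAutV g) 0 = 0 :> P by exact: rmorph0.
  by rewrite -a0 (inj_eq (@act_polyO0_inj F (3 + m) (octAutV g))).
have := fG (octAutV g); rewrite act_ratO0E // => /eqP.
rewrite eqr_div ?tofrac_eq0 // -!tofracM tofrac_eq /act_polyO0 octAutVV_mx.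
by move/eqP.
Qed.

Lemma invariant_gen f :
  @invariant_ratO0 F (3 + m) f ->
  in_generated_field (const_ratO0 F (3 + m)) gen_inv f.
Proof.
pose K := in_generated_field (const_ratO0 F (3 + m)) gen_inv.
have KP : subfield_pred K := in_generated_subfield _ _.
have [p [q [q0 ->]]] : exists p q : P, q != 0 /\ f = p%:F / q%:F.
  exists (\n_(repr f)), (\d_(repr f)); split; first exact: denom_ratioP.
  exact: frac_numden.
set f' := _ / _ => fG; have cross := invariant_cross q0 fG.
pose z := generic_point0 F (3 + m).
pose x := top z 0.
pose b := dot3 (upper x) (lower x).
pose a := x 0%N ^+ 2 + b.
have [M [j [al alE]]] := sqrt_extension (tofrac a).
pose ev : {rmorphism P -> M} := j \o tofrac.
pose io : {rmorphism F -> M} := j \o const_ratO0 F (3 + m).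
have ev_inj : injective ev.
  by move=> r s /fmorph_inj /eqP; rewrite tofrac_eq => /eqP.
have ev0 (r : P) : (ev r == 0) = (r == 0) by rewrite -(rmorph0 ev) (inj_eq ev_inj).
have two : 2%:R != 0 :> M by rewrite -(rmorph_nat io) fmorph_eq0.
pose W := map_mx ev z.
have evE r : mmap io (mxvec W 0) r = ev r.
  rewrite -[in RHS](comp_mpoly_id r) /comp_mpoly rmorph_mmap.
  apply: eq_mmap => // i; rewrite /= tnth_mktuple.
  by case/mxvec_indexP: i => i k; rewrite mxvecE mxE generic_point0E.
pose Y : 'rV[L]_(7 + m * 7) := \row_r gen_inv r.
have WY : invs W = map_mx j Y.
  by rewrite -map_invs; apply/rowP => r; rewrite [LHS]mxE [RHS]mxE [Y _ _]mxE.
have KY r : K (Y 0 r) by rewrite mxE; exact: in_generated_gen.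
have Wx k : top W 0 k = ev (x k) by rewrite /x /top /crd !mxE.
(* The generic tuple is non-degenerate because one F-point is: the tuple W1 with
   invariants Y0, and below any tuple starting with the vector v1. *)
pose W1 := sect 1 Y0.
have e1 : secdet 1 (top_vals Y0) != 0.
  have d1 := secdet_discr two_neq0 (oner_neq0 F) (t := top_vals Y0).
  have t0 : top_vals Y0 0%N = 2%:R * 1 ^+ 2 by rewrite Y0E //=; ring.
  have := d1 t0; rewrite discr_Y0 => d2.
  by apply/eqP => e0; move/esym/eqP: d2; rewrite e0 mulr0 expf_eq0 (negPf two_neq0).
have I1 : invs W1 = Y0.
  by apply: invs_sect; rewrite ?oner_eq0 // Y0E //=; ring.
have di0 : discr (top_vals (invs W)) != 0.
  pose D := discr (top_vals (generic_invs F m)).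
  have -> : discr (top_vals (invs W)) = ev D.
    by apply/esym/rmorph_discr => k; rewrite /top_vals /crd -map_invs !mxE.
  rewrite ev0; apply/eqP => D0.
  have := @rmorph_discr _ _ (mmap idfun (mxvec W1 0)) (top_vals (generic_invs F m))
    (top_vals Y0).
  rewrite -/D D0 rmorph0 discr_Y0 => H.
  have /esym/eqP : 0 = 2%:R ^+ 3 :> F.
    apply: H => k; rewrite -I1 /top_vals /crd ![lsubmx _ _ _]mxE.
    exact: (mmap_generic_invs idfun).
  by rewrite expf_eq0 (negPf two_neq0).
pose v1 : 'rV[F]_7 := \row_k nth 0 [:: 0; 1; 0; 0; 1; 0; 0] k.
pose V : 'M[F]_(3 + m, 7) := \matrix_(i, k) v1 0 k.
pose eV : {rmorphism P -> F} := mmap idfun (mxvec V 0).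
have eVX r : eV 'X_r = mxvec V 0 r by exact: mevalXU.
have xV k : (k < 7)%N -> eV (x k)
    = nth 0 [:: 0; 1; 0; 0; 1; 0; 0] k.
  by move=> k7; rewrite /x /top /crd mxE generic_point0E eVX mxvecE !mxE inordK.
have bV : eV b = 1.
  by rewrite /b /dot3 /upper /lower !rmorphD !rmorphM /= !xV //=; ring.
have b0 : b != 0.
  by apply/eqP => b0; move/eqP: bV; rewrite b0 rmorph0 eq_sym oner_eq0.
have a0 : a != 0.
  apply/eqP => a0; have := congr1 eV a0.
  rewrite rmorph0 /a rmorphD rmorphXn bV xV //= expr0n add0r => /eqP.
  by rewrite oner_eq0.
have al0 : al != 0.
  have : al ^+ 2 != 0 by rewrite alE -[j _]/(ev a) ev0.
  by rewrite expf_eq0.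
have alE' : al ^+ 2 = top W 0 0%N ^+ 2 + dot3 (upper (top W 0)) (lower (top W 0)).
  rewrite alE -[j _]/(ev a) /a /b /dot3 /upper /lower !Wx.
  by rewrite rmorphD rmorphXn !rmorphD !rmorphM.
have b0' : dot3 (upper (top W 0)) (lower (top W 0)) != 0.
  rewrite (_ : dot3 _ _ = ev b) ?ev0 //.
  by rewrite /b /dot3 /upper /lower !Wx !rmorphD !rmorphM.
have nal0 : - al != 0 by rewrite oppr_eq0.
have [g cg gE] := reduce_to_sect io F_infinite two al0 b0' alE' di0.
have [g' cg' gE'] : exists2 g, aut_closure_inv io (3 + m) g &
    W *m g = sect (- al) (invs W).
  by apply: reduce_to_sect => //; rewrite sqrrN.
have t0E s : s ^+ 2 = al ^+ 2 -> top_vals (invs W) 0%N = 2%:R * s ^+ 2.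
  move=> ->; rewrite top_vals_invs // alE' /= /form2 /dot3 /upper /lower; ring.
have de s : s != 0 -> s ^+ 2 = al ^+ 2 -> secdet s (top_vals (invs W)) != 0.
  move=> s0 sE; apply: contraNneq di0 => e0.
  by rewrite -(secdet_discr two s0 (t0E s sE)) e0 mulr0.
have Ka : K (tofrac a).
  have -> : tofrac a = Y 0 (lshift _ 0) / 2%:R.
    apply: (fmorph_inj j); rewrite -alE fmorph_div rmorph_nat.
    have -> : j (Y 0 (lshift (m * 7) 0)) = top_vals (invs W) 0%N.
      rewrite WY /top_vals /crd !mxE; congr (j (gen_inv (lshift _ _))).
      by apply: val_inj; rewrite /= inordK.
    by rewrite (t0E al (erefl _)) mulrC mulKf.
  apply: subfieldM => //; apply: subfieldV => //; exact: subfield_nat.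
have jf (g0 : 'M[M]_7) : aut_closure io (3 + m) g0 ->
    j f' * mmap io (mxvec (W *m g0) 0) q = mmap io (mxvec (W *m g0) 0) p.
  move=> cg0.
  pose h := ev q *: map_mpoly io p - ev p *: map_mpoly io q.
  have : h.@[mxvec (W *m g0) 0] = 0.
    apply: cg0 => k autk.
    rewrite mevalB !mevalZ !map_mpoly_meval -!mmap_subst !evE -!rmorphM.
    by rewrite -rmorphB mulrC cross // subrr rmorph0.
  rewrite mevalB !mevalZ !map_mpoly_meval => /eqP; rewrite subr_eq0 => /eqP E.
  have q0' : ev q != 0 by rewrite ev0.
  rewrite /f' fmorph_div -[j p%:F]/(ev p) -[j q%:F]/(ev q).
  by rewrite mulrAC -E mulrAC mulfV // mul1r.
(* Otherwise the denominator would vanish on the closure, hence, moving back by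
   the inverse of g, at the generic tuple. *)
have [k autk qk] : exists2 k, aut_mx k &
    mmap io (mxvec (W *m g *m map_mx io k) 0) q != 0.
  apply: Classical_Prop.NNPP => nk.
  have [gi [_ cgi ggi]] := cg.
  have := cgi (W *m g) (map_mpoly io q).
  rewrite -mulmxA ggi mulmx1 !map_mpoly_meval evE => qv.
  suff /eqP : ev q = 0 by rewrite ev0 (negPf q0).
  apply: qv => k autk; rewrite map_mpoly_meval; apply/eqP/negPn/negP => qk.
  by apply: nk; exists k.
have ck : aut_closure io (3 + m) (map_mx io k) by exact: aut_closure_aut.
have [[gi [cg1 _ _]] [gi' [cg1' _ _]]] := (cg, cg').
have E1 := jf _ (aut_closureM cg1 ck).
have E2 := jf _ (aut_closureM cg1' ck).
rewrite mulmxA in E1; rewrite mulmxA in E2.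
have cio c : conj_pair K j al (io c) (io c).
  by apply: conj_pairK => //; exact: in_generated_const.
have cs i : conj_pair K j al (mxvec (W *m g *m map_mx io k) 0 i)
    (mxvec (W *m g' *m map_mx io k) 0 i).
  case/mxvec_indexP: i => i l; rewrite !mxvecE gE gE' mxE [X in conj_pair _ _ _ _ X]mxE.
  elim/big_ind2: _ => [|u u' v v'|l' _].
  - exact: (conj_pair_nat KP j al 0).
  - exact: (conj_pairD KP).
  apply: (conj_pairM KP Ka alE); last by rewrite mxE; exact: cio.
  by rewrite WY; apply: (conj_pair_sect KP Ka alE) => //; rewrite -WY de // sqrrN.
exact: (conj_pair_quotient KP two al0 (conj_pair_mmap KP Ka alE p cio cs)
  (conj_pair_mmap KP Ka alE q cio cs) qk E1 E2).
Qed.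
End Main.

Theorem corollary4p8 (F : fieldType) (n : nat)
    (F_infinite : infinite_field F)
    (F_perfect : perfect_field F)
    (F_char : 2%N \notin [pchar F])
    (n_ge3 : (3 <= n)%N) :
  purely_transcendental (const_ratO0 F n) (@invariant_ratO0 F n) (7 * n - 14)%N.
Proof.
have two : 2%:R != 0 :> F by move: F_char; rewrite inE.
rewrite -(subnKC n_ge3); move: (n - 3)%N => m.
have -> : (7 * (3 + m) - 14 = 7 + m * 7)%N.
  by rewrite mulnDr (mulnC 7 m) -addnBAC.
exists (@gen_inv F m); split; first exact: gen_inv_indep.
by move=> f; split; [exact: invariant_gen | exact: gen_invariant].
Qed.
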